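(* Let $d\ge2$ and $r\ge 2$ be integers. There exists a constant $C(d,r)$, depending only on $d$ and $r$, such that for every integer $m\ge 2$ $$ \tilde D^{r,o}_m\le C(d,r)\,m^{-r}(\log m)^{d-1}, $$ where $$ \tilde D^{r,o}_m:=\inf_{\xi^1,\dots,\xi^m\in[0,1)^d}\ \inf_{\lambda_1,\dots,\lambda_m\in\mathbb{R}}\ \sup_{\mathbf z\in[0,1)^d,\ \mathbf u\in(0,1/2]^d}\left|\int_{[0,1)^d}\tilde h^r(\mathbf x,\mathbf z,\mathbf u)\,d\mathbf x-\sum_{\mu=1}^m\lambda_\mu\tilde h^r(\xi^\mu,\mathbf z,\mathbf u)\right|. $$
   Context: **Hat functions.** For $u>0$ let $h^1(x,u):=\chi_{[-u/2,u/2)}(x)$ (characteristic function of the interval, $x\in\mathbb{R}$), and inductively $h^r(\cdot,u):=h^{r-1}(\cdot,u)*h^1(\cdot,u)$ for $r\ge2$, where $(f*g)(x)=\int_{\mathbb{R}}f(x-y)g(y)\,dy$. In particular $h^2(x,u)=\max(u-|x|,0)$. For $\mathbf x,\mathbf z\in\mathbb{R}^d$ and $\mathbf u\in(0,\infty)^d$ let $h^r(\mathbf x,\mathbf z,\mathbf u):=\prod_{j=1}^d h^r(x_j-z_j,u_j)$. Its periodization in $\mathbf x$ is $\tilde h^r(\mathbf x,\mathbf z,\mathbf u):=\sum_{\mathbf m\in\mathbb{Z}^d}h^r(\mathbf m+\mathbf x,\mathbf z,\mathbf u)$. *)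

(* Defs.v *)
From HB Require Import structures.
From mathcomp Require Import all_boot all_order all_algebra.
From mathcomp Require Import all_classical all_reals all_analysis.
Set Implicit Arguments.
Unset Strict Implicit.
Unset Printing Implicit Defensive.
Import Order.TTheory GRing.Theory Num.Theory.

Local Open Scope classical_set_scope.
Local Open Scope ring_scope.

(* Lebesgue measure on R^n, with R^n represented as [n.-tuple R]: the n-fold
   product of the one-dimensional Lebesgue measure, built by recursion along
   the bijection (x, t) |-> x :: t from R * R^n to R^(n+1). *)

Definition tuple_cons (T : Type) (n : nat) (p : T * n.-tuple T) :
  n.+1.-tuple T := [tuple of p.1 :: p.2].

Definition tuple_uncons (T : Type) (n : nat) (t : n.+1.-tuple T) :
  T * n.-tuple T := (thead t, [tuple of behead t]).

Section lebesgue_succ.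
Context (R : realType) (n : nat).
Local Notation RT := (measurableTypeR R).
Variable mu : {sigma_finite_measure set (n.-tuple RT) -> \bar R}.

Lemma tuple_consK (T : Type) k : cancel (@tuple_uncons T k) (@tuple_cons T k).
Proof. by move=> t; rewrite [RHS]tuple_eta; apply: val_inj. Qed.

Lemma tuple_unconsK (T : Type) k : cancel (@tuple_cons T k) (@tuple_uncons T k).
Proof.
by move=> [x t]; rewrite /tuple_uncons/= theadE; congr pair; apply: val_inj.
Qed.

Lemma measurable_tuple_cons : measurable_fun setT (@tuple_cons RT n).
Proof. exact: measurable_cons. Qed.

Lemma measurable_tuple_uncons : measurable_fun setT (@tuple_uncons RT n).
Proof.
apply/measurable_fun_pairP; split; first exact: measurable_tnth.
exact: measurable_behead.
Qed.

Definition lebesgue_succ : set (n.+1.-tuple RT) -> \bar R :=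
  pushforward (@lebesgue_measure R \x mu)%E (@tuple_cons RT n).

Let measurable_preimage_cons A :
  measurable A -> measurable (@tuple_cons RT n @^-1` A).
Proof.
by move=> mA; rewrite -[X in measurable X]setTI; exact: measurable_tuple_cons.
Qed.

Let lebesgue_succ0 : lebesgue_succ set0 = 0%E.
Proof. by rewrite /lebesgue_succ /pushforward preimage_set0 measure0. Qed.

Let lebesgue_succ_ge0 A : (0 <= lebesgue_succ A)%E.
Proof. by rewrite /lebesgue_succ /pushforward measure_ge0. Qed.

Let lebesgue_succ_sigma_additive : semi_sigma_additive lebesgue_succ.
Proof.
move=> F mF tF mUF; rewrite /lebesgue_succ /pushforward preimage_bigcup.
apply: measure_semi_sigma_additive.
- by move=> k; exact: measurable_preimage_cons.
- apply/trivIsetP => /= i j _ _ ij; rewrite -preimage_setI.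
  by move/trivIsetP : tF => /(_ _ _ _ _ ij) ->//; rewrite preimage_set0.
- by rewrite -preimage_bigcup; exact: measurable_preimage_cons.
Qed.

HB.instance Definition _ := isMeasure.Build _ _ _ lebesgue_succ
  lebesgue_succ0 lebesgue_succ_ge0 lebesgue_succ_sigma_additive.

Let lebesgue_succ_sigma_finite : sigma_finite setT lebesgue_succ.
Proof.
have /sigma_finiteP[F [FT ndF Foo]] := sigma_finiteT (@lebesgue_measure R).
have /sigma_finiteP[G [GT ndG Goo]] := sigma_finiteT mu.
exists (fun k => @tuple_uncons RT n @^-1` (F k `*` G k)).
  rewrite -preimage_bigcup [X in _ @^-1` X](_ : _ = setT) ?preimage_setT//.
  rewrite -subTset => -[x y] _.
  have [i _ Fx] : (\bigcup_i F i) x by rewrite -FT.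
  have [j _ Gy] : (\bigcup_i G i) y by rewrite -GT.
  exists (maxn i j) => //; split => /=.
  - by move: x Fx; exact/subsetPset/ndF/leq_maxl.
  - by move: y Gy; exact/subsetPset/ndG/leq_maxr.
move=> k; have [mF Fk] := Foo k; have [mG Gk] := Goo k; split.
  rewrite -[X in measurable X]setTI; apply: measurable_tuple_uncons => //.
  exact: measurableX.
rewrite /lebesgue_succ /pushforward -comp_preimage.
rewrite [X in product_measure1 _ _ X](_ : _ = F k `*` G k); last first.
  by apply/funext => p; congr ((F k `*` G k) _); exact: tuple_unconsK.
by rewrite product_measure1E// lte_mul_pinfty// ge0_fin_numE.
Qed.

HB.instance Definition _ := Measure_isSigmaFinite.Build _ _ _
  lebesgue_succ lebesgue_succ_sigma_finite.

End lebesgue_succ.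

Fixpoint lebesgue_tuple (R : realType) (n : nat) :
    {sigma_finite_measure set (n.-tuple (measurableTypeR R)) -> \bar R} :=
  match n with
  | 0 => \d_([tuple] : 0.-tuple (measurableTypeR R))
  | n'.+1 => lebesgue_succ (lebesgue_tuple R n')
  end.

Section hat_functions.
Context (R : realType).

Definition convolution (f g : R -> R) (x : R) : R :=
  \int[@lebesgue_measure R]_y (f (x - y) * g y).

Definition hat1 (u : R) : R -> R := \1_(`[- (u / 2), u / 2[).

(* [hat r u x] is h^r(x, u). Only r >= 1 is meaningful. *)
Definition hat (r : nat) (u : R) : R -> R :=
  iter r.-1 (fun f => convolution f (hat1 u)) (hat1 u).

Definition hat_prod (d r : nat) (x z u : d.-tuple R) : R :=
  \prod_(j < d) hat r (tnth u j) (tnth x j - tnth z j).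

(* The sum over Z^d is a finitely supported sum: for r >= 1 and u in (0,oo)^d
   the function [hat_prod r ^~ z u] has bounded support, so that only finitely
   many terms are nonzero. *)
Definition hat_periodic (d r : nat) (x z u : d.-tuple R) : R :=
  \sum_(k \in [set: d.-tuple int])
    hat_prod r [tuple (tnth k j)%:~R + tnth x j | j < d] z u.

Definition unit_cube (d : nat) : set (d.-tuple R) :=
  [set x | forall j, 0 <= tnth x j < 1].

Definition half_cube (d : nat) : set (d.-tuple R) :=
  [set u | forall j, 0 < tnth u j <= 1 / 2].

Definition quadrature_error (d r m : nat) (xi : 'I_m -> d.-tuple R)
    (lambda : 'I_m -> R) (z u : d.-tuple R) : R :=
  `| \int[lebesgue_tuple R d]_(x in @unit_cube d) hat_periodic r x z u
     - \sum_(mu < m) lambda mu * hat_periodic r (xi mu) z u |.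

Definition optimal_discrepancy (d r m : nat) : \bar R :=
  ereal_inf [set ereal_inf [set ereal_sup
      [set (quadrature_error r xi lambda z u)%:E
        | z in @unit_cube d & u in @half_cube d]
    | lambda in [set: 'I_m -> R]]
  | xi in [set xi : 'I_m -> d.-tuple R | forall mu, unit_cube (xi mu)]].

End hat_functions.

(* Main.v *)
Require Import Defs.
From HB Require Import structures.
From mathcomp Require Import all_boot all_order all_algebra.
From mathcomp Require Import all_classical all_reals all_analysis.
From mathcomp Require Import measurable_realfun.
From mathcomp Require Import polyrcf complex zify ring lra.
Set Implicit Arguments.
Unset Strict Implicit.
Unset Printing Implicit Defensive.
Import Order.TTheory GRing.Theory Num.Theory.
Import Normc.
Local Open Scope ring_scope.

(** The derivative of order [r - 1] of the hat function h^r has bounded variation,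
so the Fourier coefficients of its periodization decay like |k|^-r
([hat_variation], [dft_hat_per]). For such functions a cubature rule on the
points of a lattice commits an error governed by the sum of
prod_j (1 + |k_j|)^-r over the nonzero points k of the dual lattice, and
Frolov's choice of lattice makes this sum of order m^-r (log m)^(d-1).

The lattice comes from number theory. The polynomial
prod_i (X - (4 i + 2)) - 1 is irreducible, by an argument of Schur, and has [d]
real roots, so that the product of the [d] real embeddings of an algebraic
integer is a nonzero integer ([exists_norm_form]). Rounding a large multiple of
this norm form gives an integer matrix B such that B n cannot have all its
coordinates small unless n = 0 ([exists_lattice]): if the j-th coordinate is
below P 2^(s_j) in absolute value for each j, then the sum of the s_j exceeds
[v = q d]. A
pigeonhole argument on boxes then bounds the number of lattice points in each
dyadic block ([card_dyadic_block]), and summing over the blocks gives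
2^(- v r) (v + 1)^(d-1) up to a constant ([sum_decay_lattice]), where the
logarithmic factor is the number of dyadic blocks at the critical level.

Everything is carried out on the finite group (Z/M)^d with [M = P * L], where
the functions are sampled with step [1 / L] on a torus of period [P]; the
lattice is the image of B modulo [M]. A rule on the whole dual lattice would
have far too many nodes, hence the weights are cut off by a discrete B-spline
of width about [r * L]: its translates by multiples of [L] form a partition of
unity, so that the frequency zero still gives the exact means ([window_hat0]),
and its Fourier transform decays on the scale [P], so that the other
frequencies keep the decay of the functions ([normc_window_hat]). Poisson
summation on the finite group gives the error bound ([lattice_rule_error]), and
a translate of the dual lattice with at most the average number of points in
the support of the window gives the bound on the number of nodes
([lattice_rule_nodes]). The mean over the samples differs from the integral by
a Riemann sum error, which is made negligible by taking [L] large
([hat_per_mean_error], [quadrature_at_scale]). *)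

(** * Schur polynomials and a norm form *)

Section NormForm.

Definition schur_center (i : nat) : int := (4 * i + 2)%N%:Z.

(** The centers are spaced by [4] so that the real roots of the polynomial are
separated by the multiples of [4]; at these the product is even and nonzero, and
subtracting [1] does not change its sign. *)
Definition schur_poly (d : nat) : {poly int} :=
  \prod_(i < d) ('X - (schur_center i)%:P) - 1.

Lemma schur_center_inj : injective schur_center.
Proof. by move=> i j; rewrite /schur_center => -[]; lia. Qed.

Lemma size_prod_schur_center d :
  size (\prod_(i < d) ('X - (schur_center i)%:P)) = d.+1.
Proof. by rewrite -big_enum/= size_prod_XsubC size_enum_ord. Qed.

Lemma size_schur_poly d : (0 < d)%N -> size (schur_poly d) = d.+1.
Proof.
by move=> d0; rewrite size_polyDl size_prod_schur_center// size_polyN size_poly1.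
Qed.

Lemma monic_schur_poly d : (0 < d)%N -> schur_poly d \is monic.
Proof.
move=> d0; rewrite monicE lead_coefDl; last first.
  by rewrite size_prod_schur_center size_polyN size_poly1.
by rewrite -monicE monic_prod_XsubC.
Qed.

Lemma schur_poly_center d (i : 'I_d) : (schur_poly d).[schur_center i] = -1.
Proof.
by rewrite /schur_poly hornerD horner_prod (bigD1 i)//= !hornerE subrr mul0r add0r.
Qed.

(** Schur's argument: a factorization [p1 * r] of the polynomial takes the value
[-1] at the [d] centers, so that [p1 + r] vanishes there and, having degree
less than [d], is zero; but [- p1 ^+ 2] is not monic. *)
Lemma schur_poly_irreducible d (p1 r : {poly int}) :
  (1 < size p1 <= d)%N -> schur_poly d != p1 * r.
Proof.
move=> /andP[p1_gt1 p1_le]; apply/eqP => Epr.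
have d0 : (0 < d)%N by exact: leq_trans (ltnW p1_gt1) p1_le.
have mp := monic_schur_poly d0; have sp := size_schur_poly d0.
have p_neq0 : schur_poly d != 0 by rewrite -size_poly_eq0 sp.
have p1_neq0 : p1 != 0 by rewrite -size_poly_gt0; apply: ltnW.
have r_neq0 : r != 0 by apply: contraNneq p_neq0 => r0; rewrite Epr r0 mulr0.
have sr : (size r <= d)%N.
  have : size (p1 * r) = d.+1 by rewrite -Epr.
  rewrite size_mul//; move: (size p1) (size r) p1_gt1 => a b; lia.
have p1r0 : p1 + r = 0.
  apply: contraTeq isT => s_neq0.
  have := @max_poly_roots _ (p1 + r) [seq schur_center (val i) | i : 'I_d] s_neq0.
  rewrite size_image card_ord => H.
  suff : (d < size (p1 + r)%R)%N.
    by rewrite ltnNge (leq_trans (size_polyD p1 r))// geq_max p1_le sr.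
  apply: H.
    apply/allP => x /mapP[i _ ->]; rewrite rootE hornerD.
    have : p1.[schur_center i] * r.[schur_center i] = -1.
      by rewrite -hornerM -Epr schur_poly_center.
    move: (p1.[_]) (r.[_]) => a b Hab.
    have a1 : `|a| = 1.
      have : a \is a GRing.unit by apply/unitrP; exists (- b); nia.
      by case/orP => /eqP ->.
    by apply/eqP; move: a1 Hab; case: (ltP a 0) => ? ?; nia.
  by rewrite map_inj_uniq ?enum_uniq// => i j /schur_center_inj/val_inj.
have rE : r = - p1 by apply/eqP; rewrite -addr_eq0 addrC p1r0.
have := eqP mp; rewrite Epr rE mulrN lead_coefN lead_coefM; nia.
Qed.

(** A root in common with [q] would make the gcd over the rationals nontrivial,
and by Gauss's lemma this gcd is proportional to an integer factor of the Schur
polynomial. *)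
Lemma schur_poly_no_small_root (R : rcfType) d (q : {poly int}) (x : R) :
  q != 0 -> (size q <= d)%N -> root (map_poly intr (schur_poly d)) x ->
  (map_poly intr q).[x] != 0.
Proof.
move=> q0 qd rx; apply/negP => qx.
set toQ := map_poly (intr : int -> rat).
have toR (s : {poly int}) : map_poly (intr : int -> R) s = map_poly ratr (toQ s).
  by rewrite -map_poly_comp; apply: eq_map_poly => z /=; rewrite ratr_int.
set g := gcdp (toQ (schur_poly d)) (toQ q).
have rg : root (map_poly ratr g) x.
  by rewrite gcdp_map root_gcd -!toR rx.
have gq : g %| toQ q by apply: dvdp_gcdr.
have gp : g %| toQ (schur_poly d) by apply: dvdp_gcdl.
have toQ0 : toQ q != 0 by rewrite map_poly_eq0_id0// intr_eq0 lead_coef_eq0.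
have [p1 [a a0 ga] [r Epr]] := dvdpP_rat_int gp.
have sg : size g = size p1.
  by rewrite ga size_scale// size_map_poly_id0// intr_eq0 lead_coef_eq0;
  apply: contraNneq toQ0 => p10; move: gq; rewrite ga p10 rmorph0 scaler0 dvd0p.
suff /(schur_poly_irreducible r) : (1 < size p1 <= d)%N by rewrite Epr eqxx.
rewrite -sg; apply/andP; split.
  have g0 : g != 0 by rewrite gcdp_eq0 negb_and toQ0 orbT.
  have := root_size_gt1 _ rg; rewrite size_map_poly; apply.
  by rewrite map_poly_eq0.
apply: leq_trans qd; have := dvdp_leq toQ0 gq.
by rewrite [size (toQ q)]size_map_poly_id0// intr_eq0 lead_coef_eq0.
Qed.

(** Between [4 * i] and [4 * i.+1] only the factor at the center [i] changes
sign, and an even nonzero integer keeps its sign when [1] is subtracted. *)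
Lemma schur_poly_sign d (i : 'I_d) :
  (schur_poly d).[(4 * i)%N%:Z] * (schur_poly d).[(4 * i.+1)%N%:Z] < 0.
Proof.
pose f (k : nat) := \prod_(l < d) ((4 * k)%N%:Z - schur_center l).
have fE k : (schur_poly d).[(4 * k)%N%:Z] = f k - 1.
  rewrite /schur_poly hornerD horner_prod !hornerE; congr (_ - _).
  by apply: eq_bigr => l _; rewrite !hornerE.
rewrite !fE.
have even k : exists z, f k = 2 * z.
  rewrite /f (bigD1 i)//= /schur_center.
  exists (((2 * k)%N%:Z - (2 * i + 1)%N%:Z) *
     \prod_(l < d | l != i) ((4 * k)%N%:Z - (4 * l + 2)%N%:Z)).
  by rewrite mulrA; congr (_ * _); lia.
have neg : f i * f i.+1 < 0.
  rewrite /f -big_split/= (bigD1 i)//= nmulr_rlt0; first last.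
    by rewrite /schur_center; nia.
  apply: prodr_gt0 => l li; rewrite /schur_center.
  have {li} : (l : nat) != i by [].
  by case: ltngtP => // li _; nia.
have [z1 z1E] := even i; have [z2 z2E] := even i.+1.
move: neg; rewrite z1E z2E.
have H (a b : int) : (2 * a) * (2 * b) < 0 -> (2 * a - 1) * (2 * b - 1) < 0.
  have [a0|a0] := ltP a 0 => ab.
    have b0 : 0 < b by move: ab; rewrite nmulr_rlt0; lia.
    by rewrite nmulr_rlt0; lia.
  have a1 : 0 < a by rewrite lt_neqAle a0 andbT; apply: contraTneq ab => <-; lia.
  have b0 : b < 0 by move: ab; rewrite pmulr_rlt0; lia.
  by rewrite pmulr_rlt0; lia.
exact: H.
Qed.

Lemma schur_poly_roots (R : rcfType) d : exists om : 'I_d -> R,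
  injective om /\ forall j, root (map_poly intr (schur_poly d)) (om j).
Proof.
have P (i : 'I_d) : {x : R | x \in `](4 * i)%N%:R, (4 * i.+1)%N%:R[ &
    root (map_poly intr (schur_poly d)) x}.
  apply: poly_ivtoo; first by rewrite ler_nat; lia.
  have := schur_poly_sign i; rewrite -(ltrz0 R) rmorphM/=.
  by rewrite -!(@horner_map _ _ (intr : {rmorphism int -> R})).
exists (fun i => s2val (P i)); split; last by move=> j; exact: (s2valP' (P j)).
move=> i j Eij; apply/val_inj/eqP => /=.
have := s2valP (P i); have := s2valP (P j); rewrite Eij !in_itv/=.
move: (s2val (P j)) => x /andP[jx xj] /andP[ix xi].
have := lt_trans jx xi; have := lt_trans ix xj; rewrite !ltr_nat; lia.
Qed.

(** For the roots [om j] of the polynomial, the product over [j] of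
[\sum_i n i * om j ^+ i] is the norm of an algebraic integer, hence a rational
integer: it is the determinant of multiplication by the polynomial of
coefficients [n] modulo the irreducible polynomial, in the monomial basis. *)
Lemma exists_norm_form (R : rcfType) d : (0 < d)%N ->
  exists2 W : 'M[R]_d, W \in unitmx &
    forall n : 'cV[int]_d, n != 0 ->
      1 <= \prod_j `|(W *m map_mx intr n) j 0|.
Proof.
move=> d0; have [om [om_inj om_root]] := schur_poly_roots R d.
set p := schur_poly d in om_root.
pose V := Vandermonde d (\row_j om j).
have Vu : V \in unitmx.
  rewrite unitmxE unitfE det_Vandermonde; apply/prodf_neq0 => i _.
  apply/prodf_neq0 => j ij; rewrite !mxE subr_eq0.
  by apply: contraTneq ij => /om_inj ->; rewrite ltnn.
exists V^T; first by rewrite unitmx_tr.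
move=> n n0; pose q := \poly_(i < d) n (insubd (Ordinal d0) i) 0.
have qom j : (V^T *m map_mx intr n) j 0 = (map_poly intr q).[om j].
  rewrite (@horner_coef_wide _ d); last first.
    by apply: leq_trans (size_poly _ _) _; exact: size_poly.
  rewrite mxE; apply: eq_bigr => i _; rewrite !mxE coef_map coef_poly ltn_ord/=.
  by rewrite mulrC; congr (_%:~R * _); congr (n _ _); apply/val_inj; rewrite val_insubd ltn_ord.
have q0 : q != 0.
  apply: contraNneq n0 => q0; apply/eqP/matrixP => i j; rewrite ord1 mxE.
  have := congr1 (fun s : {poly int} => s`_i) q0; rewrite coef_poly ltn_ord coef0 => <-.
  by congr (n _ _); apply/val_inj; rewrite val_insubd ltn_ord.
pose A := \matrix_(i < d, l < d) (Pdiv.Ring.rmodp ('X^i * q) p)`_l.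
have AV : map_mx intr A *m V = V *m diag_mx (\row_j (map_poly intr q).[om j]).
  apply/matrixP => i j; rewrite mul_mx_diag !mxE.
  have := congr1 (fun s : {poly int} => (map_poly intr s).[om j])
    (Pdiv.RingMonic.rdivp_eq (monic_schur_poly d0) ('X^i * q)).
  rewrite rmorphM rmorphD rmorphM/= hornerD !hornerM (eqP (om_root j)) mulr0 add0r.
  rewrite map_polyXn hornerXn => ->.
  rewrite (@horner_coef_wide _ d); last first.
    apply: leq_trans (size_poly _ _) _.
    rewrite -ltnS -(size_schur_poly d0) Pdiv.Ring.ltn_rmodpN0//.
    exact: monic_neq0 (monic_schur_poly d0).
  by apply: eq_bigr => l _; rewrite !mxE coef_map.
have detA : (\det A)%:~R = \prod_j (map_poly intr q).[om j].
  have := congr1 determinant AV; rewrite !det_mulmx det_diag mulrC det_map_mx.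
  move=> /mulrI; rewrite -unitmxE => /(_ Vu) ->.
  by apply: eq_bigr => j _; rewrite mxE.
under eq_bigr do rewrite qom.
rewrite -normr_prod -detA -intr_norm -[1]/(1%:~R) ler_int.
have : \det A != 0.
  rewrite -(intr_eq0 R) detA; apply/prodf_neq0 => j _.
  exact: schur_poly_no_small_root (size_poly _ _) (om_root j).
lia.
Qed.

End NormForm.

(** * Integer lattices with the norm property *)

Section Lattice.

Lemma matrix_entries_bounded (R : realType) m n (W : 'M[R]_(m, n)) :
  exists2 A : nat, (0 < A)%N & forall i j, `|W i j| <= A%:R.
Proof.
exists (\sum_i \sum_j (Num.truncn `|W i j|).+1).+1 => // i j.
apply: le_trans (ltW (truncnS_gt _)) _; rewrite ler_nat.
rewrite ltnW// ltnS (bigD1 i)//= (bigD1 j)//= -!addnA; exact: leq_addr.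
Qed.

(** With W the norm form, B is the rounding of P 2^(q+2) W. If the coordinates of
B n are at most P 2^(s_j), those of W n are at most 2^(s_j - q - 1), provided
that the rounding error, at most |n|_1, does not exceed P; as the product of the
coordinates of W n is at least [1], the sum of the s_j exceeds q d. The bound on
|n|_1 follows from the same inequalities and the invertibility of W, because
[P] is large compared with the coefficients of the inverse of W. *)
Lemma exists_lattice (R : realType) d : (0 < d)%N ->
  exists2 A : nat, (0 < A)%N & forall q, exists P : nat, exists B : 'M[int]_d,
  [/\ (0 < P)%N,
      forall i j, (`|B i j| <= P * 2 ^ q * A)%N &
      forall (n : 'cV[int]_d) (s : 'I_d -> nat), n != 0 ->
        (forall j, (`|(B *m n) j 0%R| < P * 2 ^ s j)%N) ->
        (q * d < \sum_j s j)%N].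
Proof.
move=> d0; have [W Wu W_norm] := exists_norm_form R d0.
have [A0 A0_gt0 WA0] := matrix_entries_bounded W.
have [A1 A1_gt0 WA1] := matrix_entries_bounded (invmx W).
exists (4 * A0 + 1)%N; first by rewrite addn1.
move=> q; pose P := (2 * d ^ 2 * A1 * 2 ^ (q * d))%N.
pose t := (2 ^ (q + 2))%N.
have t_gt0 : (0 < t)%N by rewrite expn_gt0.
have P_gt0 : (0 < P)%N by rewrite !muln_gt0 !expn_gt0 d0 A1_gt0.
pose B := \matrix_(i, j) Num.floor ((P * t)%:R * W i j).
have Bfloor i j : (B i j)%:~R <= (P * t)%:R * W i j < (B i j)%:~R + 1.
  by rewrite mxE; have := floor_itv ((P * t)%:R * W i j); rewrite intrD.
exists P, B; split=> //.
  move=> i j; rewrite -(ler_nat R) natr_absz intr_norm.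
  have -> : (P * 2 ^ q * (4 * A0 + 1))%:R = (P * t)%:R * A0%:R + (P * 2 ^ q)%:R :> R.
    by rewrite -natrM -natrD /t expnD; congr (_%:R); ring.
  have WB : `|(P * t)%:R * W i j| <= (P * t)%:R * A0%:R.
    by rewrite normrM normr_nat ler_wpM2l.
  have P1 : 1 <= (P * 2 ^ q)%:R :> R by rewrite ler1n muln_gt0 P_gt0 expn_gt0.
  have := Bfloor i j; move: WB P1; rewrite ler_norml.
  move=> /andP[? ?] ? /andP[? ?].
  by rewrite ler_norml; lra.
move=> n s n0 Hs; rewrite ltnNge; apply/negP => s_small.
pose y j := (W *m map_mx intr n) j 0.
pose N := \sum_i `|(n i 0)%:~R| : R.
have N_ge0 : 0 <= N by apply: sumr_ge0.
have s_le j : (2 ^ s j <= 2 ^ (q * d))%N.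
  by rewrite leq_exp2l// (leq_trans _ s_small)// (bigD1 j)//= leq_addr.
have By j : (P * t)%:R * `|y j| <= (P * 2 ^ s j)%:R + N.
  have -> : (P * t)%:R * `|y j| = `|(P * t)%:R * y j| by rewrite normrM normr_nat.
  have -> : (P * t)%:R * y j =
      ((B *m n) j 0)%:~R + \sum_i ((P * t)%:R * W j i - (B j i)%:~R) * (n i 0)%:~R.
    rewrite /y !mxE rmorph_sum mulr_sumr -big_split/=; apply: eq_bigr => i _.
    by rewrite !mxE rmorphM/=; ring.
  apply: le_trans (ler_normD _ _) _; apply: lerD.
    by rewrite -intr_norm -natr_absz ler_nat ltnW.
  apply: le_trans (ler_norm_sum _ _ _) _; apply: ler_sum => i _.
  rewrite normrM ler_piMl// ler_norml.
  by have := Bfloor j i; lra.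
have Pt_gt0 : 0 < (P * t)%:R :> R by rewrite ltr0n muln_gt0 P_gt0.
have sumc (c : R) : d%:R * c = \sum_(i < d) c by rewrite sumr_const card_ord mulr_natl.
have Ny : N <= (d * A1)%:R * \sum_j `|y j|.
  have nE i : (n i 0)%:~R = (invmx W *m (W *m map_mx intr n)) i 0 :> R.
    by rewrite mulKmx// mxE.
  rewrite /N natrM -mulrA sumc.
  apply: ler_sum => i _; rewrite nE mxE (le_trans (ler_norm_sum _ _ _))//.
  by rewrite mulr_sumr; apply: ler_sum => j _; rewrite normrM ler_wpM2r.
(* The bounds [Ny] and [By] only give N <= P / 2 + N / 2, which is absorbed. *)
have NP : N <= P%:R.
  have H : (P * t)%:R * N <= (d * A1)%:R * (d%:R * ((P * 2 ^ (q * d))%:R + N)).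
    apply: le_trans (ler_wpM2l (ltW Pt_gt0) Ny) _.
    rewrite mulrCA ler_wpM2l// mulr_sumr sumc.
    by apply: ler_sum => j _; apply: le_trans (By j) _; rewrite lerD2r ler_nat leq_mul2l s_le orbT.
  have PE : P%:R = 2 * (d * A1)%:R * d%:R * (2 ^ (q * d))%:R :> R.
    by rewrite -!natrM; congr (_%:R); rewrite /P; ring.
  have e1 : 1 <= (2 ^ (q * d))%:R :> R by rewrite ler1n expn_gt0.
  have t1 : 1 <= t%:R :> R by rewrite ler1n.
  have P1 : 1 <= P%:R :> R by rewrite ler1n.
  have D1 : 0 <= (d * A1)%:R * d%:R :> R by rewrite mulr_ge0.
  have PN : P%:R * N <= (P * t)%:R * N.
    by rewrite natrM ler_wpM2r// ler_peMr.
  have H2 := le_trans PN H; rewrite [(P * _)%:R]natrM in H2.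
  have H3 : 2 * P%:R * N <= P%:R * P%:R + P%:R * N.
    apply: le_trans (_ : 2 * (P%:R * N) <= _); first by rewrite mulrA.
    apply: le_trans (ler_wpM2l (ler0n _ 2) H2) _.
    have -> : 2 * ((d * A1)%:R * (d%:R * (P%:R * (2 ^ (q * d))%:R + N))) =
       P%:R * P%:R + 2 * ((d * A1)%:R * d%:R) * N by rewrite {3}PE; ring.
    rewrite lerD2l ler_wpM2r// PE.
    by have := ler_wpM2l D1 e1; lra.
  by rewrite -(ler_pM2l (lt_le_trans ltr01 P1)); lra.
have yle j : `|y j| <= (2 ^ s j)%:R / (2 ^ (q + 1))%:R.
  rewrite -(ler_pM2l Pt_gt0); apply: le_trans (By j) _.
  apply: le_trans (lerD (lexx _) NP) _.
  have -> : (P * t)%:R * ((2 ^ s j)%:R / (2 ^ (q + 1))%:R) = 2 * (P * 2 ^ s j)%:R :> R.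
    have tE : t%:R = 2 * (2 ^ (q + 1))%:R :> R by rewrite -natrM /t addn2 addn1 expnS.
    have e0 : (2 ^ (q + 1))%:R != 0 :> R by rewrite pnatr_eq0 expn_eq0.
    by rewrite (natrM R P t) (natrM R P (2 ^ s j)) tE; field.
  have : P%:R <= (P * 2 ^ s j)%:R :> R by rewrite ler_nat leq_pmulr// expn_gt0.
  lra.
have := W_norm n n0; rewrite leNgt => /negP; apply.
apply: le_lt_trans (_ : _ <= \prod_j ((2 ^ s j)%:R / (2 ^ (q + 1))%:R)) _.
  by apply: ler_prod => j _; rewrite normr_ge0 yle.
rewrite prodf_div prodr_const card_ord ltr_pdivrMr ?exprn_gt0 ?ltr0n ?expn_gt0//.
rewrite mul1r -natr_prod -natrX ltr_nat -expn_sum -expnM ltn_exp2l//.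
by rewrite (leq_ltn_trans s_small)// ltn_mul2r d0 addn1/=.
Qed.

End Lattice.

(** * Dyadic counting of lattice points *)

Section DyadicSums.

Definition ffun_cons (T : Type) d (a : T) (s : {ffun 'I_d -> T}) :
    {ffun 'I_d.+1 -> T} :=
  [ffun i => if unlift ord0 i is Some j then s j else a].

Lemma big_ffun_cons (R : nmodType) (T : finType) d
    (F : {ffun 'I_d.+1 -> T} -> R) :
  \sum_s F s = \sum_a \sum_s F (ffun_cons a s).
Proof.
rewrite pair_big/= (reindex (fun p : T * {ffun 'I_d -> T} => ffun_cons p.1 p.2))//.
exists (fun s : {ffun 'I_d.+1 -> T} => (s ord0, [ffun j => s (lift ord0 j)])).
  move=> [a s] _ /=; rewrite ffunE unlift_none; congr pair.
  by apply/ffunP => j; rewrite !ffunE liftK.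
by move=> s _; apply/ffunP => i; rewrite ffunE/=; case: unliftP => [j|] ->; rewrite ?ffunE.
Qed.

Lemma sum_ffun_cons d S a (s : {ffun 'I_d -> 'I_S}) :
  (\sum_i ffun_cons a s i = a + \sum_i s i)%N.
Proof.
rewrite big_ord_recl ffunE unlift_none; congr addn.
by apply: eq_bigr => i _; rewrite ffunE liftK.
Qed.

Lemma geometric_tail (R : realFieldType) S v :
  \sum_(a < S | (v <= a)%N) 2 ^- a <= 2 * 2 ^- v - 2 * 2 ^- maxn S v :> R.
Proof.
elim: S => [|S IH]; first by rewrite big_ord0 max0n subrr.
rewrite big_mkcond big_ord_recr/= -big_mkcond/=.
apply: le_trans (lerD IH (lexx _)) _.
case: leqP => vS.
  rewrite (maxn_idPl (leqW vS)) [2 ^+ S.+1]exprS invfM.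
  by rewrite [2 * (_ * _)]mulrA divff ?pnatr_eq0//; lra.
by rewrite (maxn_idPr vS) addr0.
Qed.

(** Peeling off one coordinate [a]: for [a <= v] the remaining coordinates
contribute the same amount [2 ^- v] up to logarithms, which costs one factor
[v + 1], and the range [a > v] is a geometric tail. *)
Lemma simplex_tail (R : realFieldType) d S v :
  \sum_(s : {ffun 'I_d.+1 -> 'I_S} | (v <= \sum_i s i)%N) 2 ^- (\sum_i s i)
    <= 2 ^+ d.+1 * 2 ^- v * (v.+1)%:R ^+ d :> R.
Proof.
elim: d v => [|d IH] v; rewrite big_mkcond big_ffun_cons/=.
  rewrite expr0 mulr1 expr1.
  have -> : \sum_(a < S) \sum_(s : {ffun 'I_0 -> 'I_S})
      (if (v <= \sum_i ffun_cons a s i)%N then 2 ^- (\sum_i ffun_cons a s i) else 0)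
      = \sum_(a < S | (v <= a)%N) 2 ^- a :> R.
    rewrite [RHS]big_mkcond/=; apply: eq_bigr => a _.
    rewrite (eq_bigr (fun=> if (v <= a)%N then 2 ^- a else 0)); last first.
      by move=> s _; rewrite sum_ffun_cons big_ord0 addn0.
    by rewrite sumr_const card_ffun !card_ord expn0.
  apply: le_trans (geometric_tail _ _ _) _.
  by rewrite lerBlDr lerDl mulr_ge0// invr_ge0 exprn_ge0.
have e2 k : 0 <= 2 ^- k :> R by rewrite invr_ge0 exprn_ge0.
have step a : \sum_(s : {ffun 'I_d.+1 -> 'I_S})
     (if (v <= \sum_i ffun_cons a s i)%N then 2 ^- (\sum_i ffun_cons a s i) else 0)
   <= 2 ^- a * (2 ^+ d.+1 * 2 ^- (v - a) * ((v - a).+1)%:R ^+ d) :> R.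
  apply: le_trans (ler_wpM2l (e2 a) (IH (v - a)%N)).
  rewrite mulr_sumr [leRHS]big_mkcond/=; apply: ler_sum => s _.
  by rewrite sum_ffun_cons leq_subLR; case: ifP => // _; rewrite exprD invfM.
apply: le_trans (ler_sum _ (fun a _ => step a)) _.
rewrite (bigID (fun a : 'I_S => (a <= v)%N))/=.
have small : \sum_(a < S | (a <= v)%N)
      2 ^- a * (2 ^+ d.+1 * 2 ^- (v - a) * ((v - a).+1)%:R ^+ d)
    <= 2 ^+ d.+1 * 2 ^- v * v.+1%:R ^+ d.+1 :> R.
  apply: le_trans (_ : \sum_(a < S | (a <= v)%N) 2 ^+ d.+1 * 2 ^- v * v.+1%:R ^+ d <= _).
    apply: ler_sum => a av.
    rewrite mulrA [2 ^- a * _]mulrCA -invfM -exprD subnKC//.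
    rewrite ler_wpM2l ?mulr_ge0 ?exprn_ge0//.
    by rewrite lerXn2r ?nnegrE// ler_nat ltnS leq_subr.
  rewrite sumr_const -[_ *+ _]mulr_natr -mulrA ler_wpM2l ?mulr_ge0 ?exprn_ge0//.
  rewrite exprS mulrC ler_wpM2r ?exprn_ge0// ler_nat.
  rewrite -[leqRHS]card_ord; apply: (@leq_card_in _ _ (fun a : 'I_S => inord a : 'I_v.+1)).
  move=> a b av bv /(congr1 val)/=.
  by rewrite !inordK ?ltnS//; exact: val_inj.
have large : \sum_(a < S | ~~ (a <= v)%N)
      2 ^- a * (2 ^+ d.+1 * 2 ^- (v - a) * ((v - a).+1)%:R ^+ d)
    <= 2 ^+ d.+1 * 2 ^- v :> R.
  rewrite (eq_big (fun a : 'I_S => (v.+1 <= a)%N) (fun a => 2 ^+ d.+1 * 2 ^- a)); first last.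
  - move=> a; rewrite -ltnNge => va.
    have -> : (v - a = 0)%N by apply/eqP; rewrite subn_eq0 ltnW.
    by rewrite expr0 invr1 mulr1 expr1n mulr1 mulrC.
  - by move=> a; rewrite -ltnNge.
  rewrite -mulr_sumr ler_wpM2l ?exprn_ge0//.
  apply: le_trans (geometric_tail _ _ _) _.
  rewrite lerBlDr exprS invfM mulrA divff ?pnatr_eq0// mul1r lerDl.
  by rewrite mulr_ge0.
apply: le_trans (lerD small large) _.
rewrite [2 ^+ d.+2]exprS -!mulrA; set X := 2 ^- v * _; set Y := 2 ^+ d.+1 * 2 ^- v.
have Y0 : 0 <= Y by rewrite mulr_ge0// exprn_ge0.
have : Y <= 2 ^+ d.+1 * X.
  by rewrite mulrA ler_peMr// exprn_ege1// ler1n.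
by move: (_ * X) => Z; lra.
Qed.

Lemma exists_subexponent (I : finType) (s : I -> nat) v :
  (v <= \sum_i s i)%N ->
  exists2 s' : I -> nat, (forall i, (s' i <= s i)%N) & (\sum_i s' i = v)%N.
Proof.
elim: v => [|v IH] vs; first by exists (fun=> 0%N) => //; rewrite big1.
have [s' s's sv] := IH (ltnW vs).
have [j s'j] : exists j, (s' j < s j)%N.
  apply/existsP; apply: contraTT vs => /existsPn Hs; rewrite -leqNgt -sv.
  by apply: leq_sum => i _; have := Hs i; rewrite -leqNgt.
exists (fun i => s' i + (i == j))%N.
  by move=> i; case: eqVneq => [->|_]; rewrite ?addn1 ?addn0.
rewrite big_split/= sv (bigD1 j)//= eqxx big1 ?addn0 ?addn1// => i.
by move/negbTE->.
Qed.

End DyadicSums.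

Section CircularSums.
Variable M' : nat.
Local Notation M := M'.+2.

(** The distance to [0] on the cycle Z/M. *)
Definition circ (x : 'I_M) : nat := minn x (M - x).

Lemma circ_le x : (circ x <= x)%N. Proof. exact: geq_minl. Qed.

Lemma circ_sub (x y : 'I_M) : (circ (x - y)%R <= `|x - y|)%N.
Proof.
rewrite /circ /= modnDmr; have := ltn_ord x; have := ltn_ord y => yM xM.
case: (leqP y x) => yx.
  have -> : (x + (M - y) = (x - y) + M)%N by lia.
  by rewrite modnDr modn_small; lia.
rewrite modn_small; lia.
Qed.

(** The frequencies of a dyadic block lie in at most 2^d 2^(|s| - v) boxes with
sides [P * 2 ^ s' j], where s' is below s and |s'| = v. Two frequencies of [H] in
the same box would have a difference contradicting the norm property. *)
Lemma card_dyadic_block d (H : {set {ffun 'I_d -> 'I_M}}) P v (s : 'I_d -> nat) :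
  (0 < P)%N ->
  (forall x y, x \in H -> y \in H -> x - y \in H) ->
  (forall k (t : 'I_d -> nat), k \in H -> k != 0 ->
     (forall j, (circ (k j) < P * 2 ^ t j)%N) -> (v < \sum_j t j)%N) ->
  (v <= \sum_j s j)%N ->
  (#|[set k in H | [forall j, circ (k j) < P * 2 ^ s j]]|
     <= 2 ^ d * 2 ^ (\sum_j s j - v))%N.
Proof.
move=> P_gt0 Hsub Hnorm vs.
have [s' s's s'v] := exists_subexponent vs.
have Q_gt0 j : (0 < P * 2 ^ s' j)%N by rewrite muln_gt0 P_gt0 expn_gt0.
pose low j (x : 'I_M) := (x < P * 2 ^ s j)%N.
pose cell j (x : 'I_M) : nat := ((if low j x then x : nat else M - x) %/ (P * 2 ^ s' j))%N.
pose F (j : 'I_d) : pred (bool * 'I_M) := fun p => (p.2 < 2 ^ (s j - s' j))%N.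
pose f (k : {ffun 'I_d -> 'I_M}) : {ffun 'I_d -> bool * 'I_M} :=
  [ffun j => (low j (k j), inord (cell j (k j)))].
have cell_lt j x : (cell j x < M)%N.
  rewrite /cell; apply: leq_ltn_trans (leq_div _ _) _.
  case: ifP => // /negbT; rewrite -leqNgt => H1.
  have : (0 < P * 2 ^ s j)%N by rewrite muln_gt0 P_gt0 expn_gt0.
  lia.
have same_cell j x y : low j x = low j y -> cell j x = cell j y ->
    (circ (x - y)%R < P * 2 ^ s' j)%N.
  rewrite /cell => <- E; apply: leq_ltn_trans (circ_sub _ _) _.
  have xM := ltn_ord x; have yM := ltn_ord y; move: E (Q_gt0 j).
  move: (P * 2 ^ s' j)%N => Q; case: (low j x) => E Q0.
    have := divn_eq x Q; have := divn_eq y Q; rewrite E.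
    by have := ltn_pmod x Q0; have := ltn_pmod y Q0; lia.
  have := divn_eq (M - x) Q; have := divn_eq (M - y) Q; rewrite E.
  by have := ltn_pmod (M - x) Q0; have := ltn_pmod (M - y) Q0; lia.
have f_inj : {in [set k in H | [forall j, circ (k j) < P * 2 ^ s j]%N] &, injective f}.
  move=> k l; rewrite !inE => /andP[kH _] /andP[lH _] E.
  apply/eqP; rewrite -subr_eq0; apply/negPn/negP => kl0.
  have := Hnorm _ s' (Hsub _ _ kH lH) kl0; rewrite s'v ltnn => H1.
  suff : false by []; apply: H1 => j; rewrite !ffunE; apply: same_cell.
    by have := congr1 (fun g : {ffun _} => (g j).1) E; rewrite !ffunE.
  have := congr1 (fun g : {ffun _} => val (g j).2) E; rewrite !ffunE/= !inordK//.
rewrite -(card_in_imset f_inj).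
apply: leq_trans (_ : #|family F| <= _)%N.
  apply: subset_leq_card; apply/fintype.subsetP => g /imsetP[k]; rewrite inE => /andP[_ /forallP kb] ->.
  apply/familyP => j; rewrite -[_ \in _]/((f k j).2 < 2 ^ (s j - s' j))%N ffunE/= inordK//.
  have := kb j; rewrite /cell /circ /low gtn_min ltn_divLR//.
  have -> : (2 ^ (s j - s' j) * (P * 2 ^ s' j) = P * 2 ^ s j)%N.
    by rewrite mulnCA -expnD subnK.
  by case: ifP.
rewrite card_family foldrE big_map -/(\prod_(j <- enum 'I_d) _)%N big_enum/=.
have -> : (2 ^ d * 2 ^ (\sum_j s j - v) = \prod_(j < d) (2 * 2 ^ (s j - s' j)))%N.
  rewrite big_split/= prod_nat_const card_ord -expn_sum; congr (_ * 2 ^ _)%N.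
  have -> : (\sum_j s j = \sum_j (s j - s' j) + \sum_j s' j)%N.
    by rewrite -big_split/=; apply: eq_bigr => j _; rewrite subnK.
  by rewrite s'v addnK.
apply: leq_prod => j _.
set e := (2 ^ _)%N; have e0 : (0 < e)%N by rewrite expn_gt0.
rewrite -card_bool -[e]card_ord -card_prod.
apply: (@leq_card_in _ _ (fun p : bool * 'I_M => (p.1, insubd (Ordinal e0) (p.2 : nat)))).
move=> [a x] [b y] /= xe ye [-> /(congr1 val)/=]; rewrite !val_insubd.
have -> : (x < e)%N by exact: xe.
by have -> : (y < e)%N by [exact: ye]; move/val_inj ->.
Qed.

(** For P > 0, the dyadic level [t] of a frequency on the scale [P], which is [0]
below [P] and otherwise satisfies P 2^(t-1) <= c < P 2^t. *)
Definition slevel P c : nat := if (c < P)%N then 0%N else (trunc_log 2 (c %/ P)).+1.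

Lemma slevel_lt P c : (0 < P)%N -> (c < P * 2 ^ slevel P c)%N.
Proof.
move=> P0; rewrite /slevel; case: (ltnP c P) => cP; first by rewrite expn0 muln1.
by rewrite mulnC -ltn_divLR// trunc_log_ltn.
Qed.

Lemma slevel_bound P c : (slevel P c <= c.+1)%N.
Proof.
rewrite /slevel; case: ifP => // _; rewrite ltnS.
apply: leq_trans (leq_div c P).
case: (posnP (c %/ P)) => [->|c0]; first by rewrite trunc_log0.
exact: leq_trans (ltnW (ltn_expl _ _)) (trunc_logP _ c0).
Qed.

Definition decay (R : realFieldType) P c : R := (1 + c%:R / P%:R)^-1.

Lemma decay_ge0 (R : realFieldType) P c : 0 <= decay R P c.
Proof. by rewrite invr_ge0 addr_ge0// divr_ge0. Qed.

Lemma decay_le_slevel (R : realFieldType) P c : (0 < P)%N ->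
  decay R P c <= 2 * 2 ^- slevel P c.
Proof.
move=> P0; rewrite /decay /slevel; have P0' : 0 < P%:R :> R by rewrite ltr0n.
have c0 : 0 <= c%:R / P%:R :> R by rewrite divr_ge0.
have c1 : 0 < 1 + c%:R / P%:R :> R by lra.
case: ltnP => cP.
  by rewrite expr0 invr1 mulr1 invf_ple ?posrE//; lra.
rewrite exprS invfM mulrA divff ?pnatr_eq0// mul1r.
rewrite lef_pV2 ?posrE ?exprn_gt0//.
rewrite -natrX; apply: le_trans (_ : (c %/ P)%:R <= _).
  by rewrite ler_nat trunc_logP// divn_gt0.
apply: le_trans (_ : c%:R / P%:R <= _); last by lra.
by rewrite ler_pdivlMr// -natrM ler_nat leq_trunc_div.
Qed.

(** The frequencies are grouped by the vector [s] of their levels: the terms of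
the group are of order 2^(- r |s|), their number is bounded by
[card_dyadic_block], and the group is empty unless |s| > v. As [r >= 2], the
remaining sum over [s] is bounded by the one in [simplex_tail]. *)
Lemma sum_decay_lattice (R : realFieldType) d (H : {set {ffun 'I_d.+1 -> 'I_M}}) P v r :
  (0 < P)%N -> (2 <= r)%N ->
  (forall x y, x \in H -> y \in H -> x - y \in H) ->
  (forall k (t : 'I_d.+1 -> nat), k \in H -> k != 0 ->
     (forall j, (circ (k j) < P * 2 ^ t j)%N) -> (v < \sum_j t j)%N) ->
  \sum_(k in H | k != 0) \prod_j decay R P (circ (k j)) ^+ r
    <= 2 ^+ (r * d.+1 + 2 * d.+1) * 2 ^- (v * r) * (v.+1)%:R ^+ d.
Proof.
move=> P0 r2 Hsub Hnorm.
have e2 k : 0 <= 2 ^- k :> R by rewrite invr_ge0 exprn_ge0.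
have e2' k : 0 <= 2 ^+ k :> R by rewrite exprn_ge0.
have lev_lt (x : 'I_M) : (slevel P (circ x) < M.+2)%N.
  rewrite !ltnS (leq_trans (slevel_bound _ _))// ltnS.
  exact: leq_trans (circ_le _) (ltnW (ltn_ord _)).
pose sg (k : {ffun 'I_d.+1 -> 'I_M}) : {ffun 'I_d.+1 -> 'I_M.+2} :=
  [ffun j => inord (slevel P (circ (k j)))].
have sgE k j : sg k j = slevel P (circ (k j)) :> nat by rewrite ffunE inordK.
have sg_big k : k \in H -> k != 0 -> (v < \sum_j sg k j)%N.
  by move=> kH k0; apply: Hnorm kH k0 _ => j; rewrite sgE slevel_lt.
apply: le_trans (_ : \sum_(k in H | k != 0) 2 ^+ (r * d.+1) * 2 ^- (r * \sum_j sg k j) <= _).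
  apply: ler_sum => k _.
  have -> : 2 ^+ (r * d.+1) * 2 ^- (r * \sum_j sg k j) =
      \prod_(j < d.+1) (2 * 2 ^- sg k j) ^+ r :> R.
    rewrite prodrXl big_split/= prodr_const card_ord exprMn -exprM.
    by rewrite prodfV prodrXr exprVn -exprM !(mulnC r).
  apply: ler_prod => j _; rewrite exprn_ge0 ?decay_ge0//=.
  by rewrite lerXn2r ?nnegrE ?decay_ge0 ?mulr_ge0// sgE decay_le_slevel.
rewrite (partition_big sg (fun s => (v <= \sum_j s j)%N))/=; last first.
  by move=> k /andP[kH k0]; apply: ltnW; exact: sg_big.
have bound (s : {ffun 'I_d.+1 -> 'I_M.+2}) : (v <= \sum_j s j)%N ->
    \sum_(k in H | (k != 0) && (sg k == s)) 2 ^+ (r * d.+1) * 2 ^- (r * \sum_j sg k j)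
    <= 2 ^+ (r * d.+1 + d.+1) * 2 ^- (v * r.-1) * 2 ^- (\sum_j s j) :> R.
  move=> vs.
  rewrite (eq_bigr (fun=> 2 ^+ (r * d.+1) * 2 ^- (r * \sum_j s j))); last first.
    by move=> k /andP[_ /andP[_ /eqP ->]].
  rewrite sumr_const.
  have cardle : (#|[pred k | (k \in H) && ((k != 0%R) && (sg k == s))]|
      <= 2 ^ d.+1 * 2 ^ (\sum_j s j - v))%N.
    apply: leq_trans (card_dyadic_block P0 Hsub Hnorm vs).
    apply: subset_leq_card; apply/fintype.subsetP => k; rewrite !inE => /andP[-> /andP[_ /eqP <-]]/=.
    by apply/forallP => j; rewrite sgE slevel_lt.
  rewrite -[leLHS]mulr_natr; move: cardle; rewrite -(ler_nat R) => cardle.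
  apply: le_trans (ler_wpM2l _ cardle) _; first by rewrite mulr_ge0.
  rewrite natrM !natrX exprD -!mulrA ler_wpM2l//.
  rewrite mulrCA ler_wpM2l//.
  have -> : (r * \sum_j s j = (\sum_j s j - v) + (v * r.-1 + \sum_j s j) + ((\sum_j s j - v) * (r - 2)))%N.
    move: vs r2; move: (\sum_j s j)%N => n vn r2.
    rewrite -[in LHS](subnK vn) -[in LHS](subnK r2); case: r r2 => [|[|r]]// _.
    by rewrite subnK// !subSS subn0/=; nia.
  rewrite exprD exprD !invfM mulrC !mulrA divff ?mul1r ?expf_neq0 ?pnatr_eq0//.
  rewrite exprD invfM -mulrA ler_wpM2l// ler_piMr//.
  by rewrite invf_le1 ?exprn_gt0// exprn_ege1// ler1n.
apply: le_trans (_ : \sum_(s : {ffun 'I_d.+1 -> 'I_M.+2} | (v <= \sum_j s j)%N)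
    2 ^+ (r * d.+1 + d.+1) * 2 ^- (v * r.-1) * 2 ^- (\sum_j s j) <= _).
  apply: ler_sum => s vs; apply: le_trans (bound s vs).
  by rewrite (eq_bigl _ _ (fun k => esym (andbA _ _ _))).
rewrite -mulr_sumr.
apply: le_trans (ler_wpM2l _ (simplex_tail _ _ _ _)) _; first by rewrite mulr_ge0.
have -> : (v * r = v * r.-1 + v)%N by rewrite -mulnSr prednK// ltnW.
have -> : (r * d.+1 + 2 * d.+1 = r * d.+1 + d.+1 + d.+1)%N by lia.
rewrite [2 ^+ (_ + _ + d.+1)]exprD [2 ^+ (v * _ + v)]exprD invfM.
by rewrite le_eqVlt; apply/orP; left; apply/eqP; ring.
Qed.

End CircularSums.

(** * Roots of unity *)

Section ComplexModulus.
Variable R : rcfType.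
Implicit Types x y : R[i].

Lemma normc_ge0 x : 0 <= normc x.
Proof. by case: x => a b; exact: sqrtr_ge0. Qed.

Lemma normc_real (a : R) : normc a%:C%C = `|a|.
Proof. by rewrite /normc/= expr0n addr0 sqrtr_sqr. Qed.

Lemma normcX x n : normc (x ^+ n) = normc x ^+ n.
Proof.
elim: n => [|n IH]; first by rewrite !expr0 normc1.
by rewrite !exprS normcM IH.
Qed.

Lemma normc_prod (I : Type) (s : seq I) (P : pred I) (F : I -> R[i]) :
  normc (\prod_(i <- s | P i) F i) = \prod_(i <- s | P i) normc (F i).
Proof.
elim/big_rec2 : _ => [|i y x _ <-]; last by rewrite normcM.
by rewrite normc1.
Qed.

Lemma normc_sum (I : Type) (s : seq I) (P : pred I) (F : I -> R[i]) :
  normc (\sum_(i <- s | P i) F i) <= \sum_(i <- s | P i) normc (F i).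
Proof.
elim/big_ind2 : _ => [|x1 x2 y1 y2 H1 H2|i _]; last by [].
  by rewrite normc0.
exact: le_trans (le_normcD _ _) (lerD H1 H2).
Qed.

Lemma normc_ge_Re x : complex.Re x <= normc x.
Proof.
case: x => a b /=; apply: le_trans (ler_norm a) _.
by rewrite -sqrtr_sqr ler_wsqrtr// lerDl sqr_ge0.
Qed.

Lemma normcB1 x : normc (x - 1) = normc (1 - x).
Proof. by rewrite -opprB normcN. Qed.

End ComplexModulus.

Section RootsOfUnity.
Variable R : realType.

Definition unit_root (M : nat) : R[i] :=
  (cos (pi *+ 2 / M%:R) +i* sin (pi *+ 2 / M%:R))%C.

Lemma unit_rootX M n : unit_root M ^+ n =
  (cos (pi *+ 2 / M%:R * n%:R) +i* sin (pi *+ 2 / M%:R * n%:R))%C.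
Proof.
elim: n => [|n IH]; first by rewrite expr0 mulr0 cos0 sin0.
rewrite exprSr IH -natr1 mulrDr mulr1 cosD sinD /unit_root.
by apply/eqP; rewrite eq_complex/= eqxx/= addrC.
Qed.

Lemma unit_rootM M : (0 < M)%N -> unit_root M ^+ M = 1.
Proof.
by move=> M0; rewrite unit_rootX divfK ?pnatr_eq0 -?lt0n// cos2pi sin2pi.
Qed.

Lemma unit_root_mul P L : (0 < P)%N -> unit_root (P * L) ^+ P = unit_root L.
Proof.
move=> P0; rewrite unit_rootX /unit_root.
have -> // : pi *+ 2 / (P * L)%:R * P%:R = pi *+ 2 / L%:R :> R.
rewrite natrM invfM -!mulrA [P%:R^-1 * _]mulrCA mulVf ?mulr1//.
by rewrite pnatr_eq0 -lt0n.
Qed.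

Lemma normc_unit_root M : normc (unit_root M) = 1.
Proof. by rewrite /normc/= cos2Dsin2 sqrtr1. Qed.

Lemma normc_unit_rootX M n : normc (unit_root M ^+ n) = 1.
Proof. by rewrite normcX normc_unit_root expr1n. Qed.

(** For angles in the second quadrant the real part is at most [0], so the chord
is at least [1]; smaller angles are doubled until they get there, and doubling
the angle at most doubles the chord. *)
Lemma normc_one_sub_unit_root_half M k : (0 < M)%N -> (0 < k)%N -> (2 * k <= M)%N ->
  2 * k%:R / M%:R <= normc (1 - unit_root M ^+ k).
Proof.
move=> M0 k0.
have [n] : exists n, (M <= 4 * k * 2 ^ n)%N.
  by exists M; apply: leq_trans (ltnW (ltn_expl M (isT : 1 < 2)%N)) _; rewrite leq_pmull// muln_gt0.
have M0' : 0 < M%:R :> R by rewrite ltr0n.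
elim: n k k0 => [|n IH] k k0 kn kM.
  have kM' : 2 * k%:R <= M%:R :> R by rewrite -natrM ler_nat.
  have kn' : M%:R <= 4 * k%:R :> R by rewrite -natrM ler_nat; lia.
  apply: le_trans (_ : 1 <= _); first by rewrite ler_pdivrMr// mul1r.
  apply: le_trans (normc_ge_Re _); rewrite unit_rootX/= lerDl oppr_ge0.
  rewrite -[X in cos X](subrK (pi / 2)) cosDpihalf oppr_le0 sin_ge0_pi//.
  have p0 := pi_gt0 R.
  have -> : pi *+ 2 / M%:R * k%:R = pi * (2 * k%:R / M%:R) :> R.
    by rewrite -mulr_natl; ring.
  have : 1 / 2 <= 2 * k%:R / M%:R :> R by rewrite ler_pdivlMr//; lra.
  have : 2 * k%:R / M%:R <= 1 :> R by rewrite ler_pdivrMr//; lra.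
  by move: (2 * k%:R / M%:R) => x x1 x2; apply/andP; split; nra.
have [Mk|kM4] := leqP M (4 * k).
  by apply: (IH k) => //; apply: leq_trans Mk _; rewrite leq_pmulr// expn_gt0.
have := IH (2 * k)%N; rewrite muln_gt0 k0 => /(_ isT) H.
have {H} H : 2 * (2 * k)%:R / M%:R <= normc (1 - unit_root M ^+ (2 * k)).
  by apply: H; [move: kn; rewrite expnS; lia | lia].
rewrite mulnC exprM -[1 in X in _ <= X](expr1n _ 2) subr_sqr normcM in H.
have H2 : normc (1 + unit_root M ^+ k) <= 2.
  apply: le_trans (le_normcD _ _) _.
  by rewrite normc_unit_rootX normc1.
have := ler_wpM2l (normc_ge0 (1 - unit_root M ^+ k)) H2.
move=> /(le_trans H); rewrite natrM => H3.
by move: H3; rewrite -[(k%:R * 2%:R)]mulrC; lra.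
Qed.

(** The chord of an angle and of its opposite agree, so the angle may be assumed
to be at most half a turn. *)
Lemma normc_one_sub_unit_root M k : (0 < k < M)%N ->
  2 * (minn k (M - k))%:R / M%:R <= normc (1 - unit_root M ^+ k).
Proof.
move=> /andP[k0 kM]; have M0 : (0 < M)%N by lia.
have [kh|kh] := leqP (2 * k) M.
  by rewrite (minn_idPl _) ?normc_one_sub_unit_root_half//; lia.
rewrite (minn_idPr _); last by lia.
have -> : normc (1 - unit_root M ^+ k) = normc (1 - unit_root M ^+ (M - k)).
  rewrite -normcB1 -[LHS]mul1r -(normc_unit_rootX M (M - k)) -normcM.
  by rewrite mulrBr -exprD subnK 1?ltnW// unit_rootM// mulr1.
by apply: normc_one_sub_unit_root_half; lia.
Qed.

Lemma unit_root_sum M k : (0 < M)%N ->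
  \sum_(a < M) unit_root M ^+ (k * a) = if (M %| k)%N then M%:R else 0.
Proof.
move=> M0; case: ifP => Mk.
  rewrite (eq_bigr (fun=> 1)) ?sumr_const ?card_ord// => a _.
  by case/dvdnP: Mk => c ->; rewrite -mulnA mulnCA exprM unit_rootM// expr1n.
have w1 : unit_root M ^+ k != 1.
  rewrite (divn_eq k M) exprD mulnC exprM unit_rootM// expr1n mul1r.
  have kM : (0 < k %% M < M)%N by rewrite lt0n ltn_pmod// andbT; apply/negbT.
  apply/eqP => E; have := normc_one_sub_unit_root kM; rewrite E subrr.
  rewrite -[0 in X in _ <= X]/(0%:C)%C normc_real normr0 leNgt => /negP; apply.
  by rewrite divr_gt0 ?mulr_gt0 ?ltr0n//; lia.
apply/eqP; have := subrX1 (unit_root M ^+ k) M.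
rewrite -exprM mulnC exprM unit_rootM// expr1n subrr => /esym/eqP.
rewrite mulf_eq0 subr_eq0 (negbTE w1)/=; under eq_bigr do rewrite -exprM.
by [].
Qed.

End RootsOfUnity.

(** * Fourier analysis on the finite torus *)

Section FiniteFourier.
Variables (R : realType) (M' : nat).
Local Notation M := M'.+2.
Local Notation w := (unit_root R M).

(** The basic additive character of Z/M. *)
Definition echar (x : 'I_M) : R[i] := w ^+ x.

Lemma unit_rootX_mod n : w ^+ (n %% M) = w ^+ n.
Proof. by rewrite [in RHS](divn_eq n M) exprD mulnC exprM unit_rootM// expr1n mul1r. Qed.

Lemma echarD x y : echar (x + y) = echar x * echar y.
Proof. by rewrite /echar/= unit_rootX_mod exprD. Qed.

Lemma echarM x y : echar (x * y) = w ^+ (x * y).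
Proof. by rewrite /echar/= unit_rootX_mod. Qed.

Lemma echar0 : echar 0 = 1. Proof. by rewrite /echar expr0. Qed.

Lemma echar_sum (I : finType) (F : I -> 'I_M) :
  echar (\sum_i F i) = \prod_i echar (F i).
Proof. by apply: (big_morph echar) => [x y|]; [exact: echarD|exact: echar0]. Qed.

Lemma normc_echar x : normc (echar x) = 1.
Proof. exact: normc_unit_rootX. Qed.

Lemma sum_echar (k : 'I_M) :
  \sum_(a : 'I_M) echar (k * a) = if k == 0 then M%:R else 0.
Proof.
under eq_bigr do rewrite echarM.
rewrite unit_root_sum//; congr (if _ then _ else _).
apply/idP/eqP => [kM|->]; last exact: dvdn0.
apply/val_inj => /=; apply/eqP; rewrite -leqn0 leqNgt; apply/negP => k0.
by have := dvdn_leq k0 kM; rewrite leqNgt ltn_ord.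
Qed.

Section Dual.
Variable d : nat.
Local Notation G := {ffun 'I_d -> 'I_M}.

Definition chi (k b : G) : R[i] := \prod_j echar (k j * b j).

Lemma chiD k l b : chi (k + l) b = chi k b * chi l b.
Proof. by rewrite -big_split; apply: eq_bigr => j _; rewrite ffunE mulrDl echarD. Qed.

(** The annihilator of [H] for the pairing [chi], that is, the dual lattice. *)
Definition dual (H : {set G}) : {set G} := [set b | [forall k in H, chi k b == 1]].

Variable H : {set G}.
Hypothesis H0 : 0 \in H.
Hypothesis Hsub : forall x y, x \in H -> y \in H -> x - y \in H.

Lemma sum_chi b : \sum_(k in H) chi k b = if b \in dual H then #|H|%:R else 0.
Proof.
rewrite inE; case: ifPn => [/forall_inP Hb|].
  by rewrite (eq_bigr (fun=> 1)) ?sumr_const// => k kH; apply/eqP/Hb.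
case/forall_inPn => h hH h1; set S := \sum_(k in H) _.
have HD k : (k + h \in H) = (k \in H).
  apply/idP/idP => kH; first by rewrite -(addrK h k) Hsub.
  by rewrite -[h]opprK -[- h]sub0r; apply: Hsub => //; exact: Hsub.
have : chi h b * S = S.
  rewrite {2}/S (reindex_inj (addIr h)) (eq_bigl _ _ HD) mulr_sumr.
  by apply: eq_bigr => k _; rewrite chiD mulrC.
move=> /eqP; rewrite -subr_eq0 -[X in _ - X]mul1r -mulrBl mulf_eq0 subr_eq0.
by rewrite (negbTE h1) => /eqP.
Qed.

Lemma poisson (Phi : G -> R[i]) :
  #|H|%:R * \sum_(b in dual H) Phi b = \sum_(k in H) \sum_b Phi b * chi k b.
Proof.
rewrite exchange_big/= mulr_sumr big_mkcond/=; apply: eq_bigr => b _.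
by rewrite -mulr_sumr sum_chi; case: ifP => _; rewrite ?mulr0// mulrC.
Qed.

(** Poisson summation for the constant function [1]. *)
Lemma card_dual : (#|H| * #|dual H| = M ^ d)%N.
Proof.
apply/eqP; rewrite -(eqr_nat R[i]); apply/eqP.
have := poisson (fun=> 1); rewrite sumr_const natrM => ->.
rewrite (bigD1 (0 : G) H0)/= [X in _ + X]big1 => [|k /andP[_ k0]].
  rewrite addr0 (eq_bigr (fun=> 1)); last first.
    move=> b _; rewrite mul1r /chi big1// => j _.
    by rewrite ffunE mul0r echar0.
  by rewrite sumr_const card_ffun !card_ord.
under eq_bigr do rewrite mul1r.
have -> : \sum_b chi k b = \prod_j \sum_a echar (k j * a) by rewrite bigA_distr_bigA.
have [j kj] : exists j, k j != 0.
  apply/existsP; apply: contraNT k0 => /existsPn k0.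
  by apply/eqP/ffunP => j; have := k0 j; rewrite negbK ffunE => /eqP.
by rewrite (bigD1 j)//= sum_echar (negbTE kj) mul0r.
Qed.

(** Averaged over all [t], the number of points of the dual of [H] that the
translation by [t] moves into the box S^d is [#|S| ^ d / #|H|]. *)
Lemma exists_translate (S : {set 'I_M}) : exists t : G,
  (#|[set b in dual H | [forall j, (b j + t j)%R \in S]]| * #|H| <= #|S| ^ d)%N.
Proof.
pose N (t : G) := #|[set b in dual H | [forall j, (b j + t j)%R \in S]]|.
have total : (\sum_t N t = #|dual H| * #|S| ^ d)%N.
  transitivity (\sum_(t : G) \sum_(b in dual H) [forall j, (b j + t j)%R \in S])%N.
    apply: eq_bigr => t _; rewrite /N -sum1_card (eq_bigl (fun b =>
      (b \in dual H) && [forall j, (b j + t j)%R \in S])); last by move=> b; rewrite inE.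
    by rewrite big_mkcondr/=; apply: eq_bigr => b _; case: ifP.
  rewrite exchange_big/= -sum_nat_const; apply: eq_bigr => b _.
  rewrite (reindex_inj (addrI (- b)))/=.
  rewrite -[X in (#|_| ^ X)%N]card_ord -card_ffun_on -sum1_card [RHS]big_mkcond/=.
  apply: eq_bigr => t _; rewrite (_ : [forall j, _] = (t \in ffun_on S)); first by case: ifP.
  apply/forallP/ffun_onP => Ht j; have := Ht j; rewrite !ffunE addrA subrr add0r //.
apply/existsP; apply: contraT => /existsPn Hlt.
have : (\sum_(t : G) (#|S| ^ d).+1 <= \sum_t N t * #|H|)%N.
  by apply: leq_sum => t _; have := Hlt t; rewrite -ltnNge.
rewrite -big_distrl/= total sum_nat_const card_ffun !card_ord -card_dual.
rewrite [leqRHS]mulnAC [(#|dual H| * #|H|)%N]mulnC leq_mul2l ltnn orbF muln_eq0.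
have -> : (#|H| == 0)%N = false by apply/negbTE; rewrite -lt0n; apply/card_gt0P; exists 0.
suff -> : (#|dual H| == 0)%N = false by [].
apply/negbTE; rewrite -lt0n; apply/card_gt0P; exists 0; rewrite inE; apply/forall_inP => k _.
by rewrite /chi big1// => j _; rewrite ffunE mulr0 echar0.
Qed.

End Dual.

End FiniteFourier.

(** * Sums of decaying factors *)

Section DecaySums.
Variable R : realFieldType.

Lemma decay_le1 P c : decay R P c <= 1.
Proof.
rewrite /decay invf_le1; first by rewrite lerDl divr_ge0.
by rewrite ltr_pwDl// divr_ge0.
Qed.

Lemma decay_anti P c1 c2 : (c1 <= c2)%N -> decay R P c2 <= decay R P c1.
Proof.
move=> c12; have h c : 0 < 1 + c%:R / P%:R :> R by rewrite ltr_pwDl// divr_ge0.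
by rewrite lef_pV2 ?posrE// lerD2l ler_wpM2r// ?invr_ge0// ler_nat.
Qed.

(** Telescoping, by 1/(n+1)^2 <= 1/n - 1/(n+1). *)
Lemma sum_inv_sq L : \sum_(n < L) decay R 1 n ^+ 2 <= 2.
Proof.
case: L => [|L]; first by rewrite big_ord0.
apply: le_trans (_ : 2 - (L.+1)%:R^-1 <= _); last by rewrite lerBlDr lerDl.
elim: L => [|L IH]; first by rewrite big_ord1 /decay mul0r addr0 invr1 expr1n; lra.
rewrite big_ord_recr/=; apply: le_trans (lerD IH (lexx _)) _.
rewrite /decay divr1 -[X in (X + L.+1%:R)]/(1%:R) -natrD add1n -(natr1 L.+1).
have : 0 < L.+1%:R :> R by rewrite ltr0n.
move: (L.+1%:R) => a a0; have a1 : 0 < a + 1 by lra.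
have cb : a^-1 - (a + 1)^-1 = a^-1 * (a + 1)^-1 by field; rewrite !gt_eqF.
have : (a + 1)^-1 ^+ 2 <= a^-1 * (a + 1)^-1.
  by rewrite expr2 ler_wpM2r ?invr_ge0 ?(ltW a1)// lef_pV2 ?posrE//; lra.
lra.
Qed.

Lemma sum_inv_sq_two_sided L :
  \sum_(n < L) decay R 1 (minn n (L.-1 - n)) ^+ 2 <= 4.
Proof.
have S2 := sum_inv_sq L.
apply: le_trans (_ : \sum_(n < L) (decay R 1 n ^+ 2 + decay R 1 (rev_ord n) ^+ 2) <= _).
  apply: ler_sum => n _; have -> : (L.-1 - n = rev_ord n)%N by rewrite /=; lia.
  have h a b : 0 <= decay R a b ^+ 2 by rewrite exprn_ge0// decay_ge0.
  by rewrite /minn; case: ifP => _; rewrite ?lerDl ?lerDr.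
have rev : \sum_(n < L) decay R 1 (rev_ord n) ^+ 2 = \sum_(n < L) decay R 1 n ^+ 2.
  by rewrite [RHS](reindex_inj rev_ord_inj).
by rewrite big_split/= rev; lra.
Qed.

(** If 1/K <= 1/A + 1/B then A B <= K (A + B). In this way a product of two
decaying factors is dominated by the decay at the sum of the frequencies times a
summable quantity. *)
Lemma decay_split P r c c1 c2 : (0 < P)%N -> (2 <= r)%N -> (c <= P * c1 + c2)%N ->
  (decay R 1 c1 * decay R P c2) ^+ r <=
  2 ^+ r * decay R P c ^+ r * (decay R 1 c1 ^+ 2 + decay R P c2 ^+ 2).
Proof.
move=> P0 r2 cc; set A := decay R 1 c1; set B := decay R P c2; set K := decay R P c.
have [A0 B0 K0] : [/\ 0 <= A, 0 <= B & 0 <= K] by rewrite !decay_ge0.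
have A1 : A <= 1 by exact: decay_le1.
have B1 : B <= 1 by exact: decay_le1.
have ABK : A * B <= K * (A + B).
  have P0' : 0 < P%:R :> R by rewrite ltr0n.
  have cR : c%:R / P%:R <= c1%:R + c2%:R / P%:R :> R.
    rewrite -[X in _ <= X + _](@mulfK _ P%:R) ?gt_eqF// -mulrDl ler_pM2r ?invr_gt0//.
    by rewrite mulrC -natrM -natrD ler_nat.
  have a0 : 0 < 1 + c1%:R :> R by rewrite ltr_pwDl.
  have b0 : 0 < 1 + c2%:R / P%:R :> R by rewrite ltr_pwDl// divr_ge0.
  have k0 : 0 < 1 + c%:R / P%:R :> R by rewrite ltr_pwDl// divr_ge0.
  rewrite /A /B /K /decay divr1.
  move: cR a0 b0 k0; move: (c%:R / P%:R) (c2%:R / P%:R) (c1%:R) => x y z xyz a0 b0 k0.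
  rewrite -(ler_pM2l k0) [leRHS]mulrA mulfV ?gt_eqF// mul1r mulrC.
  have -> : (1 + z)^-1 / (1 + y) * (1 + x) = (1 + x) / ((1 + z) * (1 + y)).
    by field; rewrite !gt_eqF.
  have -> : (1 + z)^-1 + (1 + y)^-1 = (2 + z + y) / ((1 + z) * (1 + y)).
    by field; rewrite !gt_eqF.
  by rewrite ler_pM2r ?invr_gt0 ?mulr_gt0//; lra.
apply: le_trans (_ : (K * (2 * Num.max A B)) ^+ r <= _).
  rewrite lerXn2r ?nnegrE ?mulr_ge0 ?le_max ?A0//.
  apply: le_trans ABK _; rewrite ler_wpM2l//.
  have : A <= Num.max A B by rewrite le_max lexx.
  have : B <= Num.max A B by rewrite le_max lexx orbT.
  lra.
rewrite !exprMn mulrCA mulrA ler_wpM2l ?mulr_ge0 ?exprn_ge0//.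
have h (x : R) : 0 <= x -> x <= 1 -> x ^+ r <= x ^+ 2.
  by move=> x0 x1; apply: ler_wiXn2l.
case: (leP A B) => _; first by apply: le_trans (h _ B0 B1) _; rewrite lerDr exprn_ge0.
by apply: le_trans (h _ A0 A1) _; rewrite lerDl exprn_ge0.
Qed.

End DecaySums.

(** * Discrete B-spline windows *)

Section Window.
Variables (R : realType) (M' P L r : nat).
Local Notation M := M'.+2.
Local Notation w := (unit_root R M).
Local Notation e := (@echar R M').
Hypothesis PL : (P * L = M)%N.

Let P_gt0 : (0 < P)%N. Proof. by move: PL; case: P. Qed.
Let L_gt0 : (0 < L)%N. Proof. by move: PL; case: L => //; rewrite muln0. Qed.

Lemma circD (x y : 'I_M) : (circ (x + y)%R <= circ x + circ y)%N.
Proof.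
rewrite /circ /=; have := ltn_ord x; have := ltn_ord y => yM xM.
have [xy|xy] := ltnP (x + y) M; first by rewrite modn_small//; lia.
have -> : (x + y = (x + y - M) + M)%N by lia.
by rewrite modnDr modn_small; lia.
Qed.

Lemma val_add_nat (y : 'I_M) n : y + n%:R = ((y + n) %% M)%N :> nat.
Proof. by rewrite Zp_nat /= modnDmr. Qed.

Lemma circ_mulP l : (l < L)%N -> circ ((P * l)%:R : 'I_M) = (P * minn l (L - l))%N.
Proof.
move=> lL; rewrite /circ Zp_nat /= modn_small; last by rewrite -PL ltn_mul2l P_gt0.
by rewrite -PL -mulnBr minnMr.
Qed.

Lemma echar_natM n (x : 'I_M) : e (n%:R * x) = w ^+ (n * x).
Proof. by rewrite echarM Zp_nat /= exprM unit_rootX_mod -exprM. Qed.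

(** The number of ways to write [a] as a sum of [r] elements of {0, ..., L - 1},
normalized to have total mass [L]: a discrete B-spline. *)
Definition bspline (a : 'I_M) : R :=
  L%:R / L%:R ^+ r *
  #|[set b : {ffun 'I_r -> 'I_L} | \sum_i (b i : nat)%:R == a]|%:R.

Definition dirichlet (k : 'I_M) : R[i] := \sum_(b < L) w ^+ (k * b).

(** The B-spline is the [r]-fold convolution of an indicator function, whose
transform is the Dirichlet kernel. *)
Lemma bspline_hat k :
  \sum_a (bspline a)%:C%C * e (k * a) = L%:R * (dirichlet k / L%:R) ^+ r.
Proof.
have -> : L%:R * (dirichlet k / L%:R) ^+ r = L%:R / L%:R ^+ r * dirichlet k ^+ r.
  by rewrite exprMn exprVn mulrCA mulrC mulrAC.
have -> : dirichlet k ^+ r = \prod_(i < r) dirichlet k by rewrite prodr_const card_ord.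
rewrite /dirichlet bigA_distr_bigA mulr_sumr/=.
transitivity (\sum_(a : 'I_M) \sum_(b : {ffun 'I_r -> 'I_L} | \sum_i (b i : nat)%:R == a)
    L%:R / L%:R ^+ r * \prod_i w ^+ (k * b i)).
  apply: eq_bigr => a _; rewrite /bspline -sum1_card natr_sum mulr_sumr rmorph_sum mulr_suml.
  apply: eq_big => [b|b]; rewrite inE// => /eqP <-.
  rewrite mulr1 rmorphM rmorphV/= ?unitfE ?expf_neq0 ?pnatr_eq0 -?lt0n//.
  rewrite rmorphXn !rmorph_nat; congr (_ * _).
  rewrite mulr_sumr echar_sum; apply: eq_bigr => i _.
  by rewrite mulrC echar_natM mulnC.
rewrite (exchange_big_dep xpredT)//=; apply: eq_bigr => b _.
by rewrite (eq_bigl (pred1 (\sum_i (b i : nat)%:R))) ?big_pred1_eq// => a; rewrite eq_sym.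
Qed.

Definition bspline_support : {set 'I_M} := [set a | bspline a != 0].

Lemma card_bspline_support : (0 < r)%N -> (#|bspline_support| <= r * L)%N.
Proof.
move=> r0; rewrite -[leqRHS]card_ord -cardsT.
apply: leq_trans (leq_imset_card (fun n : 'I_(r * L) => (n : nat)%:R : 'I_M) _).
apply: subset_leq_card; apply/fintype.subsetP => a; rewrite inE => a0.
have [b bE] : exists b : {ffun 'I_r -> 'I_L}, \sum_i (b i : nat)%:R == a.
  apply/existsP; apply: contraNT a0 => /existsPn Hb; rewrite /bspline.
  rewrite (eq_card0 (A := mem [set b : {ffun 'I_r -> 'I_L} | _])) ?mulr0// => b.
  by rewrite inE (negbTE (Hb b)).
have bL : (\sum_i b i < r * L)%N.
  apply: leq_trans (_ : (\sum_(i < r) b i).+1 <= _)%N; first by [].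
  rewrite -[r in (r * L)%N]card_ord -sum_nat_const.
  rewrite (bigD1 (Ordinal r0))//= [leqRHS](bigD1 (Ordinal r0))//= -addSn leq_add//.
  by apply: leq_sum => i _; exact: ltnW.
apply/imsetP; exists (Ordinal bL) => //=.
by rewrite -(eqP bE) -natr_sum.
Qed.

(** Below the scale [P] the trivial bound [L] is used, and above it the value of
the geometric sum, whose denominator is a chord. *)
Lemma normc_dirichlet k : normc (dirichlet k / L%:R) <= 2 * decay R P (circ k).
Proof.
have L0 : 0 < L%:R :> R by rewrite ltr0n.
have P0 : 0 < P%:R :> R by rewrite ltr0n.
have nL : normc (L%:R : R[i]) = L%:R by rewrite -(rmorph_nat (real_complex R)) normc_real normr_nat.
rewrite normcM normcV nL ler_pdivrMr//.
have c0 : 0 <= (circ k)%:R / P%:R :> R by rewrite divr_ge0.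
have [kP|Pk] := leqP (circ k) P.
  apply: le_trans (normc_sum _ _ _) _.
  rewrite (eq_bigr (fun=> 1)); last by move=> b _; rewrite normc_unit_rootX.
  rewrite sumr_const card_ord ler_peMl// /decay ler_pdivlMr ?mul1r; last by lra.
  have : (circ k)%:R / P%:R <= 1 :> R by rewrite ler_pdivrMr// mul1r ler_nat.
  lra.
have k0 : (0 < k < M)%N by rewrite ltn_ord andbT; move: Pk; rewrite /circ; lia.
have := normc_one_sub_unit_root R k0; rewrite -/(circ k) => Hlow.
have Hup : normc (1 - w ^+ k) * normc (dirichlet k) <= 2.
  rewrite -normcM /dirichlet.
  have -> : (1 - w ^+ k) * (\sum_(b < L) w ^+ (k * b)) = - (w ^+ (k * L) - 1).
    under eq_bigr do rewrite exprM.
    by rewrite [w ^+ (k * L)]exprM subrX1 -mulNr opprB.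
  rewrite opprB; apply: le_trans (le_normcD _ _) _.
  by rewrite normcN normc_unit_rootX normc1.
have ck0 : 0 < (circ k)%:R :> R by rewrite ltr0n; lia.
have M0 : 0 < M%:R :> R by rewrite ltr0n.
have H3 : 2 * (circ k)%:R / M%:R * normc (dirichlet k) <= 2.
  by apply: le_trans Hup; rewrite ler_wpM2r ?normc_ge0.
apply: le_trans (_ : M%:R / (circ k)%:R <= _).
  rewrite ler_pdivlMr// mulrC -(ler_pM2l (ltr0Sn R 1)).
  by rewrite -(ler_pM2r M0) in H3; move: H3; rewrite mulrAC divfK ?gt_eqF//; lra.
have PkR : 1 <= (circ k)%:R / P%:R :> R by rewrite ler_pdivlMr// mul1r ler_nat ltnW.
rewrite /decay -PL natrM mulrAC ler_wpM2r ?(ltW L0)//.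
rewrite -[P%:R / _]invf_div; move: ((circ k)%:R / P%:R) PkR => x x1.
rewrite ler_pdivlMr; last by lra.
rewrite mulrC ler_pdivrMr; lra.
Qed.

Lemma dirichlet0 : dirichlet 0 = L%:R.
Proof. by rewrite /dirichlet (eq_bigr (fun=> 1)) ?sumr_const ?card_ord. Qed.

(** At these frequencies the sum runs over all powers of a nontrivial [L]-th root
of unity. This is what makes the translates of the window a partition of unity. *)
Lemma dirichlet_mulP l : (0 < l < L)%N -> dirichlet (- (P * l)%:R) = 0.
Proof.
move=> /andP[l0 lL].
have vE : (- (P * l)%:R : 'I_M) = (P * (L - l))%N :> nat.
  have -> : - (P * l)%:R = (P * (L - l))%:R :> 'I_M.
    apply/eqP; rewrite eq_sym -subr_eq0 opprK -natrD -mulnDr subnK 1?ltnW// PL.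
    by apply/eqP/val_inj; rewrite Zp_nat /= modnn.
  by rewrite Zp_nat /= modn_small// -PL ltn_mul2l P_gt0; lia.
rewrite /dirichlet vE -PL.
under eq_bigr do rewrite -mulnA exprM unit_root_mul//.
by rewrite unit_root_sum// gtnNdvd//; lia.
Qed.

Definition dft (F : nat -> R) (l : nat) : R[i] :=
  \sum_(b < L) (F b)%:C%C * unit_root R L ^+ (l * b).

(** Modulo [L], the number [L.-1] stands for -1. *)
Lemma dvdn_add_predM a b : (b < L)%N -> (L %| b + L.-1 * a)%N = (b == a %% L)%N.
Proof.
move=> bL; rewrite /dvdn -[X in _ == X](mod0n L) -(eqn_modDr a) add0n -addnA.
by rewrite [(L.-1 * a + a)%N]addnC -mulSn prednK// [(L * a)%N]mulnC addnC modnMDl (modn_small bL).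
Qed.

Lemma dft_inversion F (a : 'I_M) :
  L%:R * (F (a %% L)%N)%:C%C = \sum_(l < L) dft F l * e (- (P * l)%:R * a).
Proof.
have eE l : e (- (P * l)%:R * a) = unit_root R L ^+ (l * (L.-1 * a)).
  rewrite mulNr.
  have h : unit_root R L ^+ (l * (L.-1 * a)) * e ((P * l)%:R * a) = 1.
    have wP : w ^+ P = unit_root R L by rewrite -PL unit_root_mul.
    rewrite echar_natM -mulnA [w ^+ _]exprM wP.
    rewrite -exprD -mulnDr addnC -mulSn prednK// mulnCA exprM unit_rootM// expr1n.
    by [].
  by rewrite -[LHS]mul1r -h -mulrA -echarD subrr echar0 mulr1.
under eq_bigr => l _ do rewrite eE /dft mulr_suml.
rewrite exchange_big/=.
have inner b : \sum_(l < L) (F b)%:C%C * unit_root R L ^+ (l * b) *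
    unit_root R L ^+ (l * (L.-1 * a)) =
    (F b)%:C%C * (if (L %| b + L.-1 * a)%N then L%:R else 0).
  rewrite -unit_root_sum// mulr_sumr; apply: eq_bigr => l _.
  by rewrite -mulrA -exprD -mulnDr mulnC.
under eq_bigr => b _ do rewrite inner dvdn_add_predM//.
have aL : (a %% L < L)%N by rewrite ltn_pmod.
rewrite (bigD1 (Ordinal aL))//= [X in _ + X]big1 => [|b bNa].
  by rewrite addr0 eqxx mulrC.
by rewrite ifF ?mulr0//; apply: contraNF bNa => /eqP E; apply/eqP/val_inj.
Qed.

(** The frequencies [k - P * l] are spaced by [P], so they lie in distinct
intervals of length [P], on which the decay is that of an inverse square. *)
Lemma sum_decay_translates (k : 'I_M) :
  \sum_(l < L) decay R P (circ (k - (P * l)%:R)%R) ^+ 2 <= 4.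
Proof.
have key (y : nat) : (y < M)%N ->
    (P * minn (y %/ P) (L.-1 - y %/ P) <= minn y (M - y))%N.
  rewrite -PL mulnC -ltn_divLR// => yL.
  have := divn_eq y P; have := ltn_pmod y P_gt0.
  move: (y %/ P)%N (y %% P)%N yL => q s qL sP ->; move: qL.
  rewrite -{1}(ltn_predK L_gt0); move: (L.-1) (ltn_predK L_gt0) => L' <- qL.
  rewrite [(q * P)%N]mulnC minnMr leq_min !geq_min leq_addr/= mulnBr mulSn [(L' * P)%N]mulnC.
  by apply/orP; right; lia.
pose x (l : 'I_L) : 'I_M := k - (P * l)%:R.
have xL l : (x l %/ P < L)%N by rewrite ltn_divLR// mulnC PL.
pose n l := Ordinal (xL l).
have n_inj : injective n.
  move=> l l' nE0; have nE : (x l %/ P = x l' %/ P)%N by exact: (congr1 val nE0).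
  have PM : (P %| M)%N by rewrite -PL dvdn_mulr.
  have xk (i : 'I_L) : (x i %% P = k %% P)%N.
    have E : ((x i + P * i) %% M)%N = k.
      by rewrite -val_add_nat /x subrK.
    by rewrite -E modn_dvdm// addnC mulnC modnMDl.
  have xE : x l = x l'.
    by apply/val_inj; rewrite /= [LHS](divn_eq (x l) P) nE (xk l) -(xk l') -divn_eq.
  have : (P * l)%:R = (P * l')%:R :> 'I_M by apply: oppr_inj; exact: (addrI k).
  move=> /(congr1 val); rewrite !Zp_nat /= !modn_small; last 2 first.
  - by rewrite -PL ltn_mul2l P_gt0 ltn_ord.
  - by rewrite -PL ltn_mul2l P_gt0 ltn_ord.
  by move=> /eqP; rewrite eqn_pmul2l// => /eqP/val_inj.
apply: le_trans (sum_inv_sq_two_sided R L); rewrite [leRHS](reindex_inj n_inj).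
apply: ler_sum => l _; rewrite lerXn2r ?nnegrE ?decay_ge0//.
set m := minn _ _.
have -> : decay R 1 m = decay R P (P * m)%N.
  by rewrite /decay natrM mulrAC divff ?pnatr_eq0 -?lt0n// mul1r divr1.
apply: decay_anti; exact: key (ltn_ord (x l)).
Qed.

(** The function [F], read modulo [L], is the superposition of characters given by
[dft_inversion], and each character translates the transform of the window. *)
Lemma window_hat F (k : 'I_M) :
  \sum_(a : 'I_M) (bspline a * F (a %% L)%N)%:C%C * e (k * a) =
  \sum_(l < L) dft F l * (dirichlet (k - (P * l)%:R) / L%:R) ^+ r.
Proof.
have L0 : L%:R != 0 :> R[i] by rewrite pnatr_eq0 -lt0n.
apply: (mulfI L0); rewrite !mulr_sumr.
transitivity (\sum_(a : 'I_M) \sum_(l < L)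
    (bspline a)%:C%C * (dft F l * e (- (P * l)%:R * a)) * e (k * a)).
  apply: eq_bigr => a _; rewrite -mulr_suml -mulr_sumr -dft_inversion rmorphM/=.
  by rewrite !mulrA [L%:R * _]mulrC.
rewrite exchange_big/=; apply: eq_bigr => l _.
rewrite mulrCA -bspline_hat mulr_sumr; apply: eq_bigr => a _.
by rewrite mulrDl echarD; ring.
Qed.

Lemma window_hat0 F : (0 < r)%N ->
  \sum_(a : 'I_M) (bspline a * F (a %% L)%N)%:C%C * e (0 * a) = dft F 0.
Proof.
move=> r0; rewrite window_hat (bigD1 (Ordinal L_gt0))//= muln0 subrr dirichlet0 divff ?pnatr_eq0 -?lt0n//.
rewrite expr1n mulr1 big1 ?addr0// => l l0.
rewrite sub0r dirichlet_mulP ?mul0r ?expr0n ?gtn_eqF ?mulr0// ltn_ord andbT lt0n.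
by apply: contraNN l0 => /eqP l0; apply/eqP/val_inj.
Qed.

(** The frequency [k] is the sum of the frequency [P * l] of the function and of
the frequency [k - P * l] of the window, each with a decay of order [r]; by
[decay_split] one of the decays passes to [k] and a summable factor remains. *)
Lemma normc_window_hat F (Cf : R) (k : 'I_M) : (2 <= r)%N -> 0 <= Cf ->
  (forall l, (l < L)%N -> normc (dft F l) <= L%:R * (Cf * decay R 1 (minn l (L - l)) ^+ r)) ->
  normc (\sum_(a : 'I_M) (bspline a * F (a %% L)%N)%:C%C * e (k * a)) <=
  L%:R * (Cf * (8 * 4 ^+ r) * decay R P (circ k) ^+ r).
Proof.
move=> r2 Cf0 HF; rewrite window_hat; apply: le_trans (normc_sum _ _ _) _.
set K := decay R P (circ k).
pose A (l : 'I_L) := decay R 1 (minn l (L - l)).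
pose B (l : 'I_L) := decay R P (circ (k - (P * l)%:R)%R).
have A0 l : 0 <= A l by exact: decay_ge0.
have B0 l : 0 <= B l by exact: decay_ge0.
have K0 : 0 <= K by exact: decay_ge0.
apply: le_trans (_ : \sum_l L%:R * (Cf * (2 ^+ r * (2 ^+ r * K ^+ r * (A l ^+ 2 + B l ^+ 2)))) <= _).
  apply: ler_sum => l _; rewrite normcM normcX.
  apply: le_trans (ler_pM (normc_ge0 _) (exprn_ge0 _ (normc_ge0 _)) (HF l (ltn_ord l)) (_ : _ <= (2 * B l) ^+ r)) _.
    by rewrite lerXn2r ?nnegrE ?normc_ge0 ?mulr_ge0// normc_dirichlet.
  rewrite -!mulrA ler_wpM2l// ler_wpM2l// exprMn mulrCA ler_wpM2l ?exprn_ge0//.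
  rewrite -/(A l) -exprMn mulrA; apply: decay_split => //.
  rewrite -circ_mulP// addnC; apply: leq_trans (circD _ _).
  by rewrite subrK.
rewrite -mulr_sumr ler_wpM2l// -mulr_sumr -[leRHS]mulrA ler_wpM2l//.
rewrite -!mulr_sumr big_split/=.
have sA : \sum_l A l ^+ 2 <= 4.
  apply: le_trans (sum_inv_sq_two_sided R L); apply: ler_sum => l _.
  rewrite lerXn2r ?nnegrE ?decay_ge0//; apply: decay_anti.
  by have := ltn_ord l; lia.
have sB : \sum_l B l ^+ 2 <= 4 by exact: sum_decay_translates.
have -> : 8 * 4 ^+ r * K ^+ r = 2 ^+ r * (2 ^+ r * K ^+ r * 8).
  have -> : 4 = 2 * 2 :> R by rewrite -natrM.
  by rewrite exprMn; ring.
rewrite ler_wpM2l ?exprn_ge0// ler_wpM2l ?mulr_ge0 ?exprn_ge0//; lra.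
Qed.

End Window.

(** * The windowed lattice rule *)

Section LatticeRule.
Variables (R : realType) (M' P L r d : nat).
Local Notation M := M'.+2.
Local Notation e := (@echar R M').
Local Notation G := {ffun 'I_d -> 'I_M}.
Hypothesis PL : (P * L = M)%N.

(** The nodes are the points (b + t) / L modulo [1] for [b] in the dual lattice,
weighted by the window. Only those [b] for which [b + t] is in the support of
the window count as nodes. *)
Definition lattice_rule (H : {set G}) (t : G) (F : 'I_d -> nat -> R) : R :=
  #|H|%:R / L%:R ^+ d * \sum_(b in dual R H)
    \prod_j (bspline R L r (b j + t j) * F j ((b j + t j)%R %% L)%N).

(** By Poisson summation the rule is a sum over the frequencies in [H]; the zero
frequency contributes the product of the means of the functions. *)
Lemma lattice_rule_error (H : {set G}) t F (Cf : R) :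
  (2 <= r)%N -> 0 \in H ->
  (forall x y, x \in H -> y \in H -> x - y \in H) -> 0 <= Cf ->
  (forall j l, (l < L)%N ->
     normc (dft L (F j) l) <= L%:R * (Cf * decay R 1 (minn l (L - l)) ^+ r)) ->
  `|lattice_rule H t F - \prod_j ((\sum_(b < L) F j b) / L%:R)| <=
  (Cf * (8 * 4 ^+ r)) ^+ d *
    \sum_(k in H | k != 0) \prod_j decay R P (circ (k j)) ^+ r.
Proof.
move=> r2 H0 Hsub Cf0 HF.
have L_gt0 : (0 < L)%N by move: PL; case: L => //; rewrite muln0.
have LC : L%:R != 0 :> R[i] by rewrite pnatr_eq0 -lt0n.
have LR : 0 < L%:R :> R by rewrite ltr0n.
have cst (S : pzSemiRingType) (x : S) : x ^+ d = \prod_(j < d) x.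
  by rewrite prodr_const card_ord.
pose g j (a : 'I_M) : R := bspline R L r a * F j (a %% L)%N.
pose gh j k : R[i] := \sum_(a : 'I_M) (g j a)%:C%C * e (k * a).
have shift j k : \sum_(a : 'I_M) (g j (a + t j))%:C%C * e (k * a) = e (- (k * t j)) * gh j k.
  rewrite /gh mulr_sumr [RHS](reindex_inj (addIr (t j))); apply: eq_bigr => a _.
  by rewrite mulrCA -echarD mulrDr [- _ + _]addrC addrK.
have ruleE : (lattice_rule H t F)%:C%C =
    \sum_(k in H) \prod_j (e (- (k j * t j)) * (gh j (k j) / L%:R)).
  rewrite /lattice_rule rmorphM/= rmorph_sum/=.
  have -> : (#|H|%:R / L%:R ^+ d)%:C%C = L%:R ^- d * #|H|%:R :> R[i].
    by rewrite rmorphM/= rmorphV/= ?unitfE ?expf_neq0 ?gt_eqF// rmorphXn/= !rmorph_nat mulrC.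
  rewrite -mulrA.
  have -> : \sum_(b in dual R H) (\prod_j (bspline R L r (b j + t j) * F j ((b j + t j)%R %% L)%N))%:C%C
     = \sum_(b in dual R H) \prod_j (g j (b j + t j))%:C%C.
    by apply: eq_bigr => b _; rewrite rmorph_prod.
  rewrite poisson// mulr_sumr; apply: eq_bigr => k _.
  have -> : \sum_(b : G) (\prod_j (g j (b j + t j))%:C%C) * chi R k b =
      \prod_j \sum_(a : 'I_M) (g j (a + t j))%:C%C * e (k j * a).
    by rewrite bigA_distr_bigA; apply: eq_bigr => b _; rewrite -big_split.
  rewrite -exprVn cst -big_split/=.
  by apply: eq_bigr => j _; rewrite shift mulrCA [_ * gh j _]mulrC.
have mainE : (\prod_j ((\sum_(b < L) F j b) / L%:R))%:C%C =
    \prod_j (e (- ((0 : G) j * t j)) * (gh j ((0 : G) j) / L%:R)) :> R[i].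
  rewrite rmorph_prod; apply: eq_bigr => j _; rewrite ffunE mul0r oppr0 echar0 mul1r.
  rewrite /gh (window_hat0 PL) 1?ltnW//.
  rewrite rmorphM/= rmorphV/= ?unitfE ?gt_eqF// rmorph_nat rmorph_sum/=; congr (_ / _).
  by apply: eq_bigr => b _; rewrite mul0n expr0 mulr1.
rewrite -normc_real.
have -> (x y : R) : (x - y)%:C%C = x%:C%C - y%:C%C by exact: rmorphB.
rewrite ruleE mainE (bigD1 (0 : G) H0) addrAC subrr add0r.
apply: le_trans (normc_sum _ _ _) _; rewrite mulr_sumr; apply: ler_sum => k _.
rewrite normc_prod cst -big_split/=.
apply: ler_prod => j _; rewrite normc_ge0/= normcM normc_echar mul1r normcM normcV.
have -> : normc (L%:R : R[i]) = L%:R.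
  by rewrite -(rmorph_nat (real_complex R)) normc_real normr_nat.
rewrite ler_pdivrMr// [leRHS]mulrC; apply: normc_window_hat => //.
exact: HF.
Qed.

Lemma lattice_rule_nodes (H : {set G}) : (0 < r)%N -> 0 \in H ->
  (forall x y, x \in H -> y \in H -> x - y \in H) ->
  exists t : G, (#|[set b in dual R H |
     [forall j, (b j + t j)%R \in bspline_support R M' L r]]| * #|H| <= (r * L) ^ d)%N.
Proof.
move=> r0 H0 Hsub.
have [t Ht] := exists_translate R H0 Hsub (bspline_support R M' L r).
exists t; apply: leq_trans Ht _.
case: (posnP d) => [->|d0]; first by rewrite !expn0.
by rewrite leq_exp2r//; exact: card_bspline_support.
Qed.

End LatticeRule.

(** * Reducing the lattice modulo a multiple of its determinant *)

Section FrequencyLattice.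

Section Modular.
Variable M' : nat.
Local Notation M := M'.+2.

Lemma intr_eq0_mod (z : int) : z%:~R = 0 :> 'I_M -> exists l : int, z = M%:Z * l.
Proof.
have nat_case (n : nat) : n%:R = 0 :> 'I_M -> exists l : int, n%:Z = M%:Z * l.
  rewrite Zp_nat => /(congr1 val)/= /eqP/dvdnP[l ->].
  by exists l%:Z; rewrite mulnC PoszM.
case: z => n; first exact: nat_case.
rewrite NegzE rmorphN => /eqP; rewrite oppr_eq0 => /eqP /nat_case[l lE].
by exists (- l); rewrite lE mulrN.
Qed.

Lemma centered_lift (x : 'I_M) : exists c : int, c%:~R = x /\ `|c|%N = circ x.
Proof.
have xM := ltn_ord x.
have xE : (x : nat)%:R = x by exact: natr_Zp.
rewrite /circ; case: (leqP x (M - x)) => h.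
  by exists x%:Z; split => //; lia.
exists (x%:Z - M%:Z); split; last by lia.
rewrite rmorphB/= -[X in _ - X]/(M%:R) -{1}[x%:~R]/((x : nat)%:R) xE.
have -> : M%:R = 0 :> 'I_M by rewrite Zp_nat; apply/val_inj; rewrite /= modnn.
by rewrite subr0.
Qed.

Variables (d : nat) (B : 'M[int]_d).

Definition mod_image (n : {ffun 'I_d -> 'I_M}) : {ffun 'I_d -> 'I_M} :=
  [ffun j => \sum_i (B j i)%:~R * n i].

Definition mod_lattice : {set {ffun 'I_d -> 'I_M}} := [set mod_image n | n in setT].

Lemma mod_lattice0 : 0 \in mod_lattice.
Proof.
apply/imsetP; exists 0; rewrite ?inE//; apply/ffunP => j; rewrite !ffunE big1// => i _.
by rewrite ffunE mulr0.
Qed.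

Lemma mod_latticeB x y : x \in mod_lattice -> y \in mod_lattice -> x - y \in mod_lattice.
Proof.
move=> /imsetP[m _ ->] /imsetP[n _ ->]; apply/imsetP; exists (m - n); rewrite ?inE//.
apply/ffunP => j; rewrite !ffunE -sumrB; apply: eq_bigr => i _.
by rewrite !ffunE mulrBr.
Qed.

(** Since the determinant of [B] divides [M], the lattice generated by [B] contains
M Z^d, so the centered representative of an element of its reduction modulo
[M] lies in it. *)
Lemma mod_lattice_lift k : (`|\det B| %| M)%N -> k \in mod_lattice ->
  exists n : 'cV[int]_d, forall j, ((B *m n) j 0)%:~R = k j /\ `|(B *m n) j 0%R|%N = circ (k j).
Proof.
move=> /dvdnP[c Mc] /imsetP[n _ ->{k}].
have [kap kapE] : exists kap : int, M%:Z = \det B * kap.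
  exists (sgz (\det B) * c%:Z); rewrite Mc PoszM mulrA [_ * sgz _]mulrC.
  by rewrite -abszEsg mulrC.
set k := mod_image n.
have lift j : {c : int | c%:~R = k j /\ `|c|%N = circ (k j)} by apply/cid/centered_lift.
have mod0 j : {l : int | sval (lift j) - \sum_i B j i * (n i : nat)%:Z = M%:Z * l}.
  apply/cid/intr_eq0_mod; rewrite rmorphB/= (svalP (lift j)).1 ffunE rmorph_sum -sumrB big1// => i _.
  by rewrite rmorphM/= -[X in _ - _ * X]/((n i : nat)%:R) natr_Zp subrr.
pose nv := \col_i (n i : nat)%:Z; pose lv := \col_j sval (mod0 j).
exists (nv + kap *: (\adj B *m lv)) => j.
have -> : (B *m (nv + kap *: (\adj B *m lv))) j 0 = sval (lift j); last exact: svalP (lift j).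
rewrite mulmxDr -scalemxAr mulmxA mul_mx_adj mul_scalar_mx scalerA mulrC -kapE !mxE.
rewrite -(svalP (mod0 j)) addrC -addrA; apply/eqP; rewrite -subr_eq0; apply/eqP.
have -> : \sum_j0 B j j0 * nv j0 0 = \sum_i B j i * (n i : nat)%:Z.
  by apply: eq_bigr => i _; rewrite mxE.
by ring.
Qed.

(** Two vectors with entries in {0, ..., K - 1} have images whose difference has
coordinates smaller than [M] in absolute value, hence is zero as soon as it is
zero modulo [M]; as [B] is injective, the vectors are then equal. *)
Lemma card_mod_lattice K T : (0 < K)%N ->
  (forall i j, (`|B i j| <= T)%N) -> (d * T * K <= M)%N ->
  (forall n : 'cV[int]_d, n != 0 -> B *m n != 0) ->
  (K ^ d <= #|mod_lattice|)%N.
Proof.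
move=> K0 BT TK Binj.
pose f (n : {ffun 'I_d -> 'I_K}) := mod_image [ffun i => (n i : nat)%:R].
have fE n j : f n j = (\sum_i B j i * (n i : nat)%:Z)%:~R.
  rewrite ffunE rmorph_sum; apply: eq_bigr => i _; by rewrite ffunE rmorphM.
have f_inj : injective f.
  move=> n n' E.
  pose v := \col_i ((n i : nat)%:Z - (n' i : nat)%:Z).
  have Bv : B *m v = 0.
    apply/matrixP => j o; rewrite ord1 [RHS]mxE.
    have BvE : (B *m v) j 0 = \sum_i B j i * (n i : nat)%:Z - \sum_i B j i * (n' i : nat)%:Z.
      by rewrite mxE -sumrB; apply: eq_bigr => i _; rewrite mxE mulrBr.
    have : ((B *m v) j 0)%:~R = 0 :> 'I_M.
      by rewrite BvE rmorphB/= -!fE E subrr.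
    move=> /intr_eq0_mod[l lE]; rewrite lE.
    have bound : (`|(B *m v) j 0%R| < M)%N.
      have le1 : (`|(B *m v) j 0%R| <= d * T * K.-1)%N.
        rewrite -lez_nat abszE mxE; apply: le_trans (ler_norm_sum _ _ _) _.
        apply: le_trans (_ : \sum_(i < d) (T * K.-1)%N%:Z <= _).
          apply: ler_sum => i _; rewrite normrM PoszM ler_pM//.
            by rewrite -abszE lez_nat BT.
          rewrite mxE -abszE lez_nat; have := ltn_ord (n i); have := ltn_ord (n' i).
          by move: (n i : nat) (n' i : nat) => p p'; lia.
        by rewrite sumr_const card_ord -mulnA PoszM -mulr_natl natz.
      apply: leq_ltn_trans le1 _; case: (posnP (d * T)) => [->|dT]; first by rewrite mul0n.
      apply: leq_trans TK; rewrite ltn_mul2l dT; lia.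
    move: bound; rewrite lE abszM /= ; case: (eqVneq l 0) => [->|l0]; first by rewrite mulr0.
    by rewrite -[X in (_ < X)%N]muln1 ltn_mul2l/= ltnNge lt0n absz_eq0 l0.
  apply/ffunP => i; apply/val_inj.
  have : v = 0 by apply/eqP; apply: contraTT isT => /Binj; rewrite Bv eqxx.
  by move=> /matrixP/(_ i 0); rewrite !mxE => /eqP; rewrite subr_eq0 => /eqP[].
rewrite -[K in (K ^ _)%N]card_ord -[X in (_ ^ X)%N]card_ord -card_ffun -(card_imset _ f_inj).
apply: subset_leq_card; apply/fintype.subsetP => k /imsetP[n _ ->].
by apply/imsetP; exists [ffun i => (n i : nat)%:R]; rewrite ?inE.
Qed.

End Modular.

(** A lattice in (Z/M)^d whose nonzero elements have a large product of coordinates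
on the scale [P], and whose cardinality is, up to a constant factor, at least
the number expected from its density. The factor [K] allows [L] to be taken as
large as desired. *)
Lemma exists_frequency_lattice (R : realType) d : (0 < d)%N ->
  exists2 A : nat, (0 < A)%N & forall q K, (0 < K)%N ->
  exists M' P L K', exists H : {set {ffun 'I_d -> 'I_M'.+2}},
  [/\ (P * L = M'.+2)%N, (K <= L)%N, (L = 2 * d * 2 ^ q * A * K')%N,
      (0 < K')%N & (K' ^ d <= #|H|)%N] /\
  [/\ 0 \in H, (forall x y, x \in H -> y \in H -> x - y \in H) &
      forall k (t : 'I_d -> nat), k \in H -> k != 0 ->
        (forall j, (circ (k j) < P * 2 ^ t j)%N) -> (q * d < \sum_j t j)%N].
Proof.
move=> d0; have [A A0 HA] := exists_lattice R d0; exists A => // q K K0.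
have [P [B [P0 BT NP]]] := HA q.
have Binj (n : 'cV[int]_d) : n != 0 -> B *m n != 0.
  move=> n0; apply/eqP => Bn; suff : (q * d < \sum_(j < d) 0)%N by rewrite big1.
  by apply: (NP n (fun=> 0%N) n0) => j; rewrite Bn mxE muln1.
have detB : (0 < `|\det B|)%N.
  rewrite absz_gt0 -det_tr; apply/negP => /det0P[v v0 vB].
  have := Binj v^T; rewrite trmx_eq0 => /(_ v0)/negP; apply.
  by apply/eqP/trmx_inj; rewrite trmx_mul trmxK vB trmx0.
pose K' := (`|\det B| * K)%N; pose L := (2 * d * 2 ^ q * A * K')%N.
have K'0 : (0 < K')%N by rewrite muln_gt0 detB.
have PL1 : (1 < P * L)%N.
  have : (0 < P * (d * 2 ^ q * A * K'))%N by rewrite !muln_gt0 P0 d0 expn_gt0 A0 detB K0.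
  by rewrite /L -!mulnA [(P * (2 * _))%N]mulnCA; lia.
have ME : (P * L = (P * L - 2).+2)%N by lia.
exists (P * L - 2)%N, P, L, K', (mod_lattice (P * L - 2) B).
have card_ok : (K' ^ d <= #|mod_lattice (P * L - 2) B|)%N.
  apply: (card_mod_lattice (T := (P * 2 ^ q * A)%N)) => //.
  by rewrite -ME /L; nia.
split; split=> //.
- by rewrite /L /K' mulnA leq_pmull// !muln_gt0 d0 expn_gt0 A0 detB.
- exact: mod_lattice0.
- exact: mod_latticeB.
move=> k t kH k0 kt.
have MD : (`|\det B| %| (P * L - 2).+2)%N.
  by rewrite -ME /L /K' mulnA [(_ * (_ * K))%N]mulnA mulnAC dvdn_mull.
have [n Hn] := mod_lattice_lift MD kH.
apply: (NP n).
  apply: contraNneq k0 => n0; apply/eqP/ffunP => j.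
  by rewrite -(Hn j).1 n0 mulmx0 mxE ffunE.
by move=> j; rewrite (Hn j).2.
Qed.

End FrequencyLattice.

Import numFieldNormedType.Exports.
Local Open Scope classical_set_scope.

(** * Moving averages *)

Section MovingAverage.
Variable R : realType.
Local Notation mu := (@lebesgue_measure R).

Lemma measurable_translation c :
  measurable_fun setT ((fun x => x + c) : measurableTypeR R -> measurableTypeR R).
Proof.
by apply: continuous_measurable_fun => x; apply: cvgD; [exact: cvg_id|exact: cvg_cst].
Qed.

Lemma lebesgue_measure_translation c (A : set R) : measurable A ->
  pushforward mu ((fun x => x + c) : _ -> measurableTypeR R) A = mu A.
Proof.
pose mixin := isMeasurableFun.Build _ _ _ _ _ (measurable_translation c).
pose phi : {mfun measurableTypeR R >-> measurableTypeR R} := HB.pack (fun x : R => x + c) mixin.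
move=> mA; apply/esym/(@lebesgue_measure_unique _ (pushforward mu phi)) => //= _ [[a b]] _ <-.
rewrite /pushforward.
have -> : (fun x => x + c) @^-1` `]a, b] = `]a - c, b - c].
  by apply/seteqP; split=> x /=; rewrite !in_itv/= ltrBlDr lerBrDr.
rewrite !lebesgue_measure_itv/= !lte_fin ltrD2r; case: ifP => // _.
by rewrite -!EFinB opprB addrA subrK.
Qed.

Lemma Rintegral_translation c (F : R -> R) :
  mu.-integrable setT (EFin \o F) -> mu.-integrable setT (EFin \o (fun y => F (y + c))) ->
  \int[mu]_y F (y + c) = \int[mu]_y F y.
Proof.
move=> iF iFc; rewrite /Rintegral; congr fine.
have mc := measurable_translation c.
have mF : measurable_fun setT (EFin \o F : measurableTypeR R -> \bar R) by exact: measurable_int iF.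
have := @integral_pushforward _ _ _ _ _ _ mc mu setT _ mF.
rewrite preimage_setT => /(_ iFc measurableT) <-.
apply: eq_measure_integral => A mA _.
exact: lebesgue_measure_translation.
Qed.

Definition window_integral (g : R -> R) (a b x : R) : R :=
  \int[mu]_y (g (x - y) * \1_(`[a, b[) y).

Section Bounded.
Variables (g : R -> R) (C : R).
Hypotheses (mg : measurable_fun setT g) (gC : forall x, `|g x| <= C).

Lemma integrable_window a b x :
  mu.-integrable setT (EFin \o (fun y => g (x - y) * \1_(`[a, b[ : set R) y)).
Proof.
have mgx : measurable_fun setT (fun y : R => g (x - y)).
  apply: measurableT_comp => //; apply: continuous_measurable_fun => y.
  by apply: cvgB; [exact: cvg_cst|exact: cvg_id].
have -> : EFin \o (fun y => g (x - y) * \1_(`[a, b[ : set R) y) =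
   ((EFin \o (fun y : R => g (x - y))) \* (EFin \o (\1_(`[a, b[ : set R) : R -> R)))%E.
  by apply/funext => y /=; rewrite EFinM.
apply: integrableMr => //.
  by exists C; split; [exact: num_real|move=> e Ce y _; exact: le_trans (gC _) (ltW Ce)].
exact: integrable_indic_itv.
Qed.

(** Translating the window changes the integral by two short windows at its ends. *)
Lemma window_integral_shift a b dl x : a <= b -> 0 <= dl ->
  window_integral g a b (x + dl) - window_integral g a b x =
  window_integral g (a - dl) a x - window_integral g (b - dl) b x.
Proof.
move=> ab dl0; rewrite /window_integral.
have E y : g (x + dl - (y + dl)) * \1_(`[a, b[ : set R) (y + dl) =
    g (x - y) * \1_(`[a - dl, b - dl[ : set R) y.
  congr (g _ * _); first by rewrite opprD addrACA subrr addr0.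
  by rewrite !indicE !mem_setE !in_itv/= lerBlDr ltrBrDr.
have -> : \int[mu]_y (g (x + dl - y) * \1_(`[a, b[) y) =
    \int[mu]_y (g (x - y) * \1_(`[a - dl, b - dl[) y).
  rewrite -(@Rintegral_translation dl (fun y => g (x + dl - y) * \1_(`[a, b[ : set R) y)).
  - by apply: eq_Rintegral => y _; exact: E.
  - exact: integrable_window.
  - by under eq_fun do rewrite E; exact: integrable_window.
rewrite -RintegralB//; try exact: integrable_window.
rewrite -RintegralB//; try exact: integrable_window.
apply: eq_Rintegral => y _; rewrite -!mulrBr; congr (_ * _).
rewrite !indicE !mem_setE !in_itv/=.
by case: (leP (a - dl) y); case: (ltP y (b - dl)); case: (leP a y); case: (ltP y b);
  case: (ltP y a); case: (leP (b - dl) y) => /=; lra.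
Qed.

End Bounded.

Lemma Rintegral_ord_sum N (f : nat -> R -> R) :
  (forall n, mu.-integrable setT (EFin \o f n)) ->
  mu.-integrable setT (EFin \o (fun y => \sum_(n < N) f n y)) /\
  \int[mu]_y (\sum_(n < N) f n y) = \sum_(n < N) \int[mu]_y f n y.
Proof.
move=> fi; elim: N => [|N [IH1 IH2]].
  split; last by rewrite big_ord0 /Rintegral; under eq_integral do rewrite big_ord0; rewrite integral0.
  have -> : EFin \o (fun y : R => \sum_(n < 0) f n y) = cst 0%E.
    by apply/funext => y /=; rewrite big_ord0.
  exact: integrable0.
have E : (fun y => \sum_(n < N.+1) f n y) = (fun y => \sum_(n < N) f n y + f N y).
  by apply/funext => y; rewrite big_ord_recr.
rewrite E big_ord_recr/= -IH2 -RintegralD//; split=> //.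
exact: (@integrableD _ _ _ mu setT measurableT _ _ IH1 (fi N)).
Qed.

Lemma lebesgue_measure_co (a b : R) : a <= b -> mu (`[a, b[ : set R) = (b - a)%:E.
Proof.
move=> ab; rewrite lebesgue_measure_itv/= lte_fin.
by move: ab; rewrite le_eqVlt => /orP[/eqP ->|->]; rewrite ?ltxx ?subrr// -EFinB.
Qed.

Lemma Rintegral_indic_co a b : a <= b -> \int[mu]_y \1_(`[a, b[ : set R) y = b - a.
Proof.
move=> ab; have muab := lebesgue_measure_co ab.
by rewrite /Rintegral integral_indic// setIT [X in fine X]muab.
Qed.

(** The sum is taken inside the integral, where it is bounded by the variation [V]
uniformly in the translation. *)
Lemma sum_window_integral_le (g : R -> R) C a b N (x : nat -> R) V :
  measurable_fun setT g -> (forall x, `|g x| <= C) -> a <= b ->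
  (forall y, \sum_(n < N) `|g (x n - y)| <= V) ->
  \sum_(n < N) `|window_integral g a b (x n)| <= V * (b - a).
Proof.
move=> mg gC ab gV.
have mg' : measurable_fun setT (fun x => `|g x|) by exact: measurableT_comp.
have gC' y : `| `|g y| | <= C by rewrite normr_id.
have ig n := integrable_window mg' gC' a b (x n).
have [is_ sE] := Rintegral_ord_sum N ig.
apply: le_trans (_ : \sum_(n < N) window_integral (fun x => `|g x|) a b (x n) <= _).
  apply: ler_sum => n _; rewrite /window_integral.
  apply: le_trans (le_normr_Rintegral _ _) _ => //; first exact: integrable_window.
  rewrite le_eqVlt; apply/orP; left; apply/eqP; apply: eq_Rintegral => y _.
  by rewrite normrM [X in _ * X]ger0_norm.
rewrite /window_integral -sE -(Rintegral_indic_co ab) -RintegralZl//; last exact: integrable_indic_itv.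
apply: le_Rintegral => //.
  exact: (integrableZl measurableT V (integrable_indic_itv a b true true)).
by move=> y _; rewrite -mulr_suml ler_wpM2r.
Qed.

Lemma normr_window_integral_le (g : R -> R) C a b x :
  measurable_fun setT g -> (forall x, `|g x| <= C) -> a <= b ->
  `|window_integral g a b x| <= C * (b - a).
Proof.
move=> mg gC ab; have := @sum_window_integral_le g C a b 1 (fun=> x) C mg gC ab.
by rewrite big_ord1; apply => y; rewrite big_ord1.
Qed.

Definition fdiff (dl : R) (g : R -> R) (x : R) : R := g (x + dl) - g x.

Lemma iter_fdiffB k dl f g : iter k (fdiff dl) (fun x => f x - g x) =
  (fun x => iter k (fdiff dl) f x - iter k (fdiff dl) g x).
Proof.
elim: k => //= k ->; apply/funext => x; rewrite /fdiff; lra.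
Qed.

Lemma measurable_fdiff dl (g : R -> R) :
  measurable_fun setT g -> measurable_fun setT (fdiff dl g).
Proof.
move=> mg; apply: measurable_funB => //.
exact: measurableT_comp mg (measurable_translation dl).
Qed.

Lemma iter_fdiff_window k dl (g : R -> R) C a b :
  measurable_fun setT g -> (forall x, `|g x| <= C) ->
  [/\ measurable_fun setT (iter k (fdiff dl) g),
      forall x, `|iter k (fdiff dl) g x| <= 2 ^+ k * C &
      iter k (fdiff dl) (window_integral g a b) =
        window_integral (iter k (fdiff dl) g) a b].
Proof.
move=> mg gC; elim: k => [|k [m1 b1 E1]].
  by split=> //= x; rewrite expr0 mul1r.
split.
- exact: measurable_fdiff.
- move=> x; rewrite /= /fdiff; apply: le_trans (ler_normB _ _) _.
  by have := b1 x; have := b1 (x + dl); rewrite exprS; lra.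
- rewrite !iterS E1; apply/funext => x; rewrite /fdiff /window_integral -RintegralB//; try exact: integrable_window m1 b1 _ _ _.
  by apply: eq_Rintegral => y _; rewrite -mulrBl addrAC.
Qed.

End MovingAverage.

(** * Hat functions *)

Section Hat.
Variable R : realType.
Variable u : R.
Hypothesis u0 : 0 < u.
Hypothesis u1 : u <= 1.
Local Notation mu := (@lebesgue_measure R).

Let u2 : - (u / 2) <= u / 2. Proof. by move: u0; lra. Qed.

Lemma hatS s : hat s.+2 u = window_integral (hat s.+1 u) (- (u / 2)) (u / 2).
Proof. by []. Qed.

Lemma hat1_bounds x : 0 <= hat1 u x <= 1.
Proof. by rewrite /hat1 indicE; case: (_ \in _); rewrite /= ?lexx ?ler01. Qed.

Lemma lipschitz_measurable (f : R -> R) (K : R) :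
  (forall x dl, 0 <= dl -> `|f (x + dl) - f x| <= K * dl) -> measurable_fun setT f.
Proof.
move=> fK; apply: continuous_measurable_fun => x.
have K0 : 0 <= K by have := fK 0 1 ler01; rewrite mulr1; apply: le_trans.
have fK2 y : `|f x - f y| <= K * `|x - y|.
  case: (leP y x) => xy.
    by have := fK y (x - y); rewrite subr_ge0 xy [y + _]addrC subrK => /(_ isT); rewrite [`|x - y|]ger0_norm ?subr_ge0.
  rewrite distrC [`|x - y|]distrC; have := fK x (y - x).
  by rewrite subr_ge0 (ltW xy) [x + _]addrC subrK => /(_ isT); rewrite [`|y - x|]ger0_norm ?subr_ge0 ?(ltW xy).
have K1 : 0 < K + 1 by move: K0; lra.
apply/cvgrPdist_le => e e0; near=> y.
apply: le_trans (fK2 y) _.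
have : `|x - y| <= e / (K + 1).
  by near: y; apply: cvgr_dist_le; [exact: cvg_id|exact: divr_gt0].
rewrite ler_pdivlMr// => H; apply: le_trans H; rewrite mulrC ler_wpM2l//; lra.
Unshelve. all: by end_near. Qed.

Lemma hat_bounds s : measurable_fun setT (hat s.+1 u) /\ forall x, 0 <= hat s.+1 u x <= 1.
Proof.
elim: s => [|s [IHm IHb]].
  split; last exact: hat1_bounds.
  by apply: measurable_indic; exact: measurable_itv.
have gb x : `|hat s.+1 u x| <= 1.
  by have /andP[h0 h1] := IHb x; rewrite ger0_norm.
split.
  apply: (@lipschitz_measurable _ 2) => x dl dl0.
  rewrite hatS (window_integral_shift IHm gb)//; apply: le_trans (ler_normB _ _) _.
  have le1 a : a - dl <= a by rewrite lerBlDr lerDl.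
  apply: le_trans (lerD (normr_window_integral_le _ IHm gb (le1 _)) (normr_window_integral_le _ IHm gb (le1 _))) _.
  lra.
move=> x; rewrite hatS; apply/andP; split.
  apply: Rintegral_ge0 => y _; rewrite mulr_ge0//.
  by have /andP[] := IHb (x - y).
apply: le_trans (ler_norm _) _; apply: le_trans (normr_window_integral_le _ IHm gb u2) _.
by move: u1; lra.
Qed.

Lemma normr_hat_le1 s x : `|hat s.+1 u x| <= 1.
Proof. by have /andP[h0 h1] := (hat_bounds s).2 x; rewrite ger0_norm. Qed.

Lemma hat_lipschitz s x dl : 0 <= dl -> `|hat s.+2 u (x + dl) - hat s.+2 u x| <= 2 * dl.
Proof.
move=> dl0; have [IHm _] := hat_bounds s; have gb := normr_hat_le1 s.
rewrite hatS (window_integral_shift IHm gb)//; apply: le_trans (ler_normB _ _) _.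
have le1 a : a - dl <= a by rewrite lerBlDr lerDl.
apply: le_trans (lerD (normr_window_integral_le _ IHm gb (le1 _)) (normr_window_integral_le _ IHm gb (le1 _))) _.
lra.
Qed.

Lemma hat_support s x : s.+1%:R * (u / 2) < `|x| -> hat s.+1 u x = 0.
Proof.
elim: s x => [|s IH] x.
  rewrite mul1r /hat/= /hat1 indicE mem_setE in_itv/= => ux.
  case: andP => // -[x1 x2]; move: ux; rewrite ltNge ler_norml; move: u0; lra.
move=> ux; rewrite hatS /window_integral.
rewrite (@eq_Rintegral _ _ _ mu setT (cst 0)); first by rewrite Rintegral_cst// mul0r.
move=> y _ /=; rewrite indicE mem_setE in_itv/=.
case: andP => [[y1 y2]|]; last by rewrite mulr0.
rewrite IH ?mul0r//; have := lerB_normD x (- y).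
have : `|- y| <= u / 2 by rewrite normrN ler_norml; lra.
by move: ux; rewrite -(natr1 s.+1) mulrDl mul1r; lra.
Qed.

(** An indicator function of an interval is the difference of two monotone steps,
each of total variation [1]. *)
Lemma hat1_variation x dl N : 0 <= dl ->
  \sum_(n < N) `|fdiff dl (hat1 u) (x + n%:R * dl)| <= 2.
Proof.
move=> dl0; pose step (c y : R) : R := (c <= y)%R%:R.
have hE y : hat1 u y = step (- (u / 2)) y - step (u / 2) y.
  rewrite /hat1 indicE mem_setE in_itv/= /step.
  by move: u0; case: (leP (- (u / 2)) y); case: (ltP y (u / 2)) => /=; lra.
have mono c y : step c y <= step c (y + dl).
  by rewrite /step ler_nat; case: (leP c y) => // cy; rewrite (le_trans cy)// lerDl.
have tele c : \sum_(n < N) (step c (x + n%:R * dl + dl) - step c (x + n%:R * dl)) <= 1.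
  have -> : \sum_(n < N) (step c (x + n%:R * dl + dl) - step c (x + n%:R * dl)) =
      step c (x + N%:R * dl) - step c (x + 0%:R * dl).
    elim: N => [|N IH]; first by rewrite big_ord0 subrr.
    rewrite big_ord_recr/= IH.
    have -> : x + N.+1%:R * dl = x + N%:R * dl + dl by rewrite -natr1 mulrDl mul1r addrA.
    by lra.
  by rewrite /step; case: (c <= x + N%:R * dl); case: (c <= x + 0 * dl) => /=; lra.
apply: le_trans (_ : \sum_(n < N)
   ((step (- (u / 2)) (x + n%:R * dl + dl) - step (- (u / 2)) (x + n%:R * dl)) +
    (step (u / 2) (x + n%:R * dl + dl) - step (u / 2) (x + n%:R * dl))) <= _).
  apply: ler_sum => n _; rewrite /fdiff !hE.
  have := mono (- (u / 2)) (x + n%:R * dl); have := mono (u / 2) (x + n%:R * dl).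
  by rewrite ler_norml; lra.
by rewrite big_split/=; have := tele (- (u / 2)); have := tele (u / 2); lra.
Qed.

(** One difference of the outermost average over a window leaves two windows of
length [dl], and the remaining differences fall on the inner function. *)
Lemma hat_variation s x dl N : 0 <= dl ->
  \sum_(n < N) `|iter s.+1 (fdiff dl) (hat s.+1 u) (x + n%:R * dl)| <= 2 ^+ s.+1 * dl ^+ s.
Proof.
move=> dl0; elim: s x => [|s IH] x; first by rewrite expr0 mulr1 expr1; exact: hat1_variation.
have [mh _] := hat_bounds s; have gb := normr_hat_le1 s.
have E : iter s.+2 (fdiff dl) (hat s.+2 u) = fun x =>
   window_integral (iter s.+1 (fdiff dl) (hat s.+1 u)) (- (u / 2) - dl) (- (u / 2)) x -
   window_integral (iter s.+1 (fdiff dl) (hat s.+1 u)) (u / 2 - dl) (u / 2) x.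
  rewrite iterSr.
  have -> : fdiff dl (hat s.+2 u) = fun x =>
     window_integral (hat s.+1 u) (- (u / 2) - dl) (- (u / 2)) x -
     window_integral (hat s.+1 u) (u / 2 - dl) (u / 2) x.
    by apply/funext => y; rewrite /fdiff hatS (window_integral_shift mh gb).
  rewrite iter_fdiffB.
  have [_ _ ->] := iter_fdiff_window s.+1 dl (- (u / 2) - dl) (- (u / 2)) mh gb.
  by have [_ _ ->] := iter_fdiff_window s.+1 dl (u / 2 - dl) (u / 2) mh gb.
have [m1 b1 _] := iter_fdiff_window s.+1 dl 0 0 mh gb.
have V y : \sum_(n < N) `|iter s.+1 (fdiff dl) (hat s.+1 u) (x + n%:R * dl - y)| <= 2 ^+ s.+1 * dl ^+ s.
  by under eq_bigr do rewrite addrAC; exact: IH.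
have le1 a : a - dl <= a by rewrite lerBlDr lerDl.
have W a := @sum_window_integral_le R _ _ (a - dl) a N (fun n => x + n%:R * dl) _ m1 b1 (le1 a) V.
rewrite E; apply: le_trans (_ : \sum_(n < N)
   (`|window_integral (iter s.+1 (fdiff dl) (hat s.+1 u)) (- (u / 2) - dl) (- (u / 2)) (x + n%:R * dl)| +
   `|window_integral (iter s.+1 (fdiff dl) (hat s.+1 u)) (u / 2 - dl) (u / 2) (x + n%:R * dl)|) <= _).
  by apply: ler_sum => n _; exact: ler_normB.
rewrite big_split/=; apply: le_trans (lerD (W _) (W _)) _.
by rewrite !subKr [2 ^+ s.+2]exprS [dl ^+ s.+1]exprSr; lra.
Qed.

End Hat.

(** * Discrete Fourier coefficients of periodized hat functions *)

Section SummationByParts.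
Variable R : realType.

Lemma sum_ord_mul (V : nmodType) (F : nat -> V) N L :
  \sum_(c < N * L) F c = \sum_(i < N) \sum_(b < L) F (i * L + b)%N.
Proof.
elim: N => [|N IH]; first by rewrite !big_ord0.
rewrite big_ord_recr/= -IH -addn1 mulnDl mul1n.
by rewrite big_split_ord/=.
Qed.

Lemma summation_by_parts (g : nat -> R) (x : R[i]) n : g 0%N = 0 -> g n = 0 ->
  (1 - x) * (\sum_(c < n) (g c)%:C%C * x ^+ c) =
  x * \sum_(c < n) (g c.+1 - g c)%:C%C * x ^+ c.
Proof.
move=> g0 gn; apply/eqP; rewrite -subr_eq0; apply/eqP.
have tele m : (1 - x) * (\sum_(c < m) (g c)%:C%C * x ^+ c) -
    x * (\sum_(c < m) (g c.+1 - g c)%:C%C * x ^+ c) = (g 0%N)%:C%C - (g m)%:C%C * x ^+ m.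
  elim: m => [|m IH]; first by rewrite !big_ord0 expr0; ring.
  rewrite !big_ord_recr/= !mulrDr opprD addrACA IH exprS.
  have -> : (g m.+1 - g m)%:C%C = (g m.+1)%:C%C - (g m)%:C%C by exact: rmorphB.
  by ring.
by rewrite tele g0 gn; ring.
Qed.

Lemma iter_fdiff_right (h : R -> R) rho dl : 0 <= dl ->
  (forall x, rho < x -> h x = 0) -> forall k x, rho < x -> iter k (fdiff dl) h x = 0.
Proof.
move=> dl0 hr; elim=> [|k IH] x rx /=; first exact: hr.
by rewrite /fdiff !IH ?subr0// (lt_le_trans rx)// lerDl.
Qed.

Lemma iter_fdiff_left (h : R -> R) rho dl : 0 <= dl ->
  (forall x, x < - rho -> h x = 0) ->
  forall k x, x + k%:R * dl < - rho -> iter k (fdiff dl) h x = 0.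
Proof.
move=> dl0 hr; elim=> [|k IH] x rx /=; first by apply: hr; move: rx; rewrite mul0r addr0.
have E : k.+1%:R * dl = k%:R * dl + dl by rewrite -natr1 mulrDl mul1r.
rewrite E in rx; rewrite /fdiff !IH ?subr0//; first by move: rx; lra.
by rewrite -addrA [dl + _]addrC.
Qed.

(** For a compactly supported function sampled with step [dl], summation by parts
trades each factor [1 - x] for a difference, without boundary terms. *)
Lemma normc_exp_sum (h : R -> R) rho dl x0 n (x : R[i]) k :
  0 <= dl -> (forall y, rho < `|y| -> h y = 0) -> normc x = 1 ->
  x0 + k%:R * dl < - rho -> rho < x0 + n%:R * dl ->
  normc (1 - x) ^+ k * normc (\sum_(c < n) (h (x0 + c%:R * dl))%:C%C * x ^+ c) <=
  \sum_(c < n) `|iter k (fdiff dl) h (x0 + c%:R * dl)|.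
Proof.
move=> dl0 hr x1 left right.
have -> : normc (1 - x) ^+ k * normc (\sum_(c < n) (h (x0 + c%:R * dl))%:C%C * x ^+ c) =
   normc (\sum_(c < n) (iter k (fdiff dl) h (x0 + c%:R * dl))%:C%C * x ^+ c).
  elim: k left => [|k IH] left; first by rewrite expr0 mul1r.
  have E : k.+1%:R * dl = k%:R * dl + dl by rewrite -natr1 mulrDl mul1r.
  have left' : x0 + k%:R * dl < - rho by move: left; rewrite E; lra.
  rewrite exprS -mulrA IH// -normcM
    (@summation_by_parts (fun c => iter k (fdiff dl) h (x0 + c%:R * dl))).
  - rewrite normcM x1 mul1r; congr normc; apply: eq_bigr => c _.
    have Ec : x0 + c.+1%:R * dl = x0 + c%:R * dl + dl by rewrite -natr1 mulrDl mul1r addrA.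
    by rewrite Ec.
  - apply: (@iter_fdiff_left _ rho) => //.
      move=> y yr; apply: hr; rewrite -normrN (lt_le_trans _ (ler_norm _))//; lra.
    by rewrite mul0r addr0.
  - apply: (@iter_fdiff_right _ rho) => // y yr.
    by apply: hr; rewrite (lt_le_trans _ (ler_norm _)).
apply: le_trans (normc_sum _ _ _) _; apply: ler_sum => c _.
by rewrite normcM normcX x1 expr1n mulr1 normc_real.
Qed.

End SummationByParts.

Section Periodization.
Variables (R : realType) (s : nat).
Local Notation r := s.+2.
Local Notation W := (2 * r + 1)%N.
Local Notation N := (2 * W + 1)%N.

(** The periodization, restricted to the arguments in [0, 1): for [z] in [0, 1) and
[u] at most [1 / 2], the shifts by more than [W] miss the support. *)
Definition hat_per (u z x : R) : R := \sum_(i < N) hat r u (i%:R - W%:R + x - z).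

Variables (u z : R).
Hypothesis u0 : 0 < u.
Hypothesis u12 : u <= 1 / 2.
Hypothesis z01 : 0 <= z < 1.

Let u1 : u <= 1. Proof. by move: u12; lra. Qed.

Lemma hat_support_r x : r%:R / 4 < `|x| -> hat r u x = 0.
Proof.
move=> rx; apply: hat_support => //; apply: le_lt_trans rx.
rewrite ler_wpM2l//; move: u12; lra.
Qed.

(** Summing over the shifts and over the samples of one period is summing over all
samples of the hat function. Its [r]-th differences have sum at most
2^r L^(1 - r), and each difference gains the chord 1 - e(l / L), which is at
least 2 min(l, L - l) / L. *)
Lemma dft_hat_per L l : (l < L)%N ->
  normc (dft L (fun b => hat_per u z (b%:R / L%:R)) l) <=
  L%:R * ((2 ^+ r + N%:R) * decay R 1 (minn l (L - l)) ^+ r).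
Proof.
move=> lL; have L0 : (0 < L)%N by exact: leq_ltn_trans lL.
have L0R : 0 < L%:R :> R by rewrite ltr0n.
pose dl : R := L%:R^-1; have dl0 : 0 <= dl by rewrite invr_ge0.
have dl1 : dl <= 1 by rewrite invf_le1// ler1n.
pose x0 : R := - W%:R - z.
have dftE : dft L (fun b => hat_per u z (b%:R / L%:R)) l =
    \sum_(c < N * L) (hat r u (x0 + c%:R * dl))%:C%C * (unit_root R L ^+ l) ^+ c.
  rewrite (sum_ord_mul (fun c => (hat r u (x0 + c%:R * dl))%:C%C * (unit_root R L ^+ l) ^+ c)).
  rewrite exchange_big/= /dft; apply: eq_bigr => b _.
  rewrite /hat_per rmorph_sum mulr_suml; apply: eq_bigr => i _; congr (_%:C%C * _).
    congr (hat _ _ _); rewrite /x0 [(i * L + b)%:R]natrD [(i * L)%:R]natrM mulrDl /dl mulfK ?gt_eqF//.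
    by move: (_ / _) => y; ring.
  have E : (l * (i * L + b) = L * (l * i) + l * b)%N by ring.
  by rewrite -exprM E exprD [_ ^+ (L * _)]exprM unit_rootM// expr1n mul1r.
have sup : \sum_(c < N * L) `|hat r u (x0 + c%:R * dl)| <= L%:R * N%:R.
  apply: le_trans (ler_sum _ (fun c _ => normr_hat_le1 u0 u1 _ _)) _.
  by rewrite sumr_const card_ord natrM mulrC.
case: (posnP l) => [l0|l0].
  rewrite dftE l0 expr0 min0n; apply: le_trans (normc_sum _ _ _) _.
  under eq_bigr do rewrite expr1n mulr1 normc_real.
  apply: le_trans sup _; rewrite ler_wpM2l// /decay mul0r addr0 invr1 expr1n mulr1.
  by rewrite lerDr exprn_ge0.
have w1 : normc (unit_root R L ^+ l) = 1 by exact: normc_unit_rootX.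
have key : normc (1 - unit_root R L ^+ l) ^+ r *
    normc (dft L (fun b => hat_per u z (b%:R / L%:R)) l) <= 2 ^+ r * dl ^+ s.+1.
  rewrite dftE; apply: le_trans (hat_variation u0 u1 s.+1 x0 (N * L) dl0).
  apply: (@normc_exp_sum _ _ (r%:R / 4)) => //; first exact: hat_support_r.
  - have rd : r%:R * dl <= r%:R by rewrite ler_piMr.
    have W2 : W%:R = 2 * r%:R + 1 :> R by rewrite natrD natrM.
    have r_ge0 : 0 <= r%:R :> R by [].
    rewrite /x0 W2; move/andP: z01 => [z0 _]; move: rd r_ge0; lra.
  - have -> : (N * L)%:R * dl = N%:R by rewrite natrM mulfK ?gt_eqF.
    have W2 : W%:R = 2 * r%:R + 1 :> R by rewrite natrD natrM.
    have N2 : N%:R = 2 * W%:R + 1 :> R by rewrite natrD natrM.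
    have r_ge0 : 0 <= r%:R :> R by [].
    rewrite /x0 N2 W2; move/andP: z01 => [_ z1]; move: r_ge0; lra.
set m := minn l (L - l).
have m0 : (0 < m)%N by rewrite /m; lia.
have m0R : 0 < m%:R :> R by rewrite ltr0n.
have low : 2 * m%:R / L%:R <= normc (1 - unit_root R L ^+ l).
  by apply: normc_one_sub_unit_root; rewrite l0.
have mL : 0 < 2 * m%:R / L%:R :> R by rewrite divr_gt0// mulr_gt0.
have key2 : (2 * m%:R / L%:R) ^+ r * normc (dft L (fun b => hat_per u z (b%:R / L%:R)) l) <= 2 ^+ r * dl ^+ s.+1.
  apply: le_trans key; by rewrite ler_wpM2r ?normc_ge0// lerXn2r ?nnegrE ?normc_ge0// ltW.
have mL0 : 0 < (2 * m%:R / L%:R) ^+ r :> R by rewrite exprn_gt0.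
rewrite -(ler_pM2l mL0); apply: le_trans key2 _.
have -> : 2 ^+ r * dl ^+ s.+1 = (2 * m%:R / L%:R) ^+ r * (L%:R * m%:R ^- r).
  have mm : m%:R ^+ r * m%:R^-1 ^+ r = 1 :> R by rewrite exprVn divff// expf_neq0// gt_eqF.
  have LL : dl * L%:R = 1 by rewrite mulVf// gt_eqF.
  rewrite -[L%:R^-1]/dl -exprVn !exprMn [dl ^+ r]exprSr.
  transitivity (2 ^+ r * dl ^+ s.+1 * (m%:R ^+ r * m%:R^-1 ^+ r) * (dl * L%:R)); last by ring.
  by rewrite mm LL !mulr1.
rewrite ler_wpM2l ?(ltW mL0)// ler_wpM2l//.
apply: le_trans (_ : 2 ^+ r * decay R 1 m ^+ r <= _).
  rewrite -exprMn -exprVn lerXn2r ?nnegrE ?mulr_ge0 ?decay_ge0// ?invr_ge0//.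
  have m1 : 1 <= m%:R :> R by rewrite ler1n.
  have m1' : 0 < 1 + m%:R :> R by move: m1; lra.
  by rewrite /decay divr1 ler_pdivlMr// mulrC ler_pdivrMr//; lra.
by rewrite ler_wpM2r ?exprn_ge0 ?decay_ge0// lerDl.
Qed.

End Periodization.

(** * Riemann sums and the periodization *)

Section RiemannSums.
Variable R : realType.
Local Notation mu := (@lebesgue_measure R).

Variables (f : R -> R) (C K : R).
Hypothesis mf : measurable_fun setT f.
Hypothesis fC : forall x, `|f x| <= C.
Hypothesis fK : forall x dl, 0 <= dl -> `|f (x + dl) - f x| <= K * dl.

Lemma integrable_co (h : R -> R) (D : R) (a b : R) : measurable_fun setT h ->
  (forall x, `|h x| <= D) -> mu.-integrable (`[a, b[ : set R) (EFin \o h).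
Proof.
move=> mh hD; apply: measurable_bounded_integrable => //.
- have [ab|ba] := leP a b.
    by have muab := lebesgue_measure_co ab; rewrite [X in (X < _)%E]muab ltry.
  by rewrite set_itv_ge ?measure0// bnd_simp -leNgt ltW.
- exact: measurable_funTS.
- by exists D; split; [exact: num_real|move=> e De y _; exact: le_trans (hD _) (ltW De)].
Qed.

Lemma cell_integral_error a dl : 0 <= dl ->
  `|\int[mu]_(x in `[a, a + dl[) f x - dl * f a| <= dl * (K * dl).
Proof.
move=> dl0; have adl : a <= a + dl by rewrite lerDl.
have muI : fine (mu (`[a, a + dl[ : set R)) = dl by rewrite lebesgue_measure_co//= addrAC subrr add0r.
have cst_int (c : R) : \int[mu]_(x in `[a, a + dl[) c = dl * c.
  by rewrite Rintegral_cst// [X in c * X]muI mulrC.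
have mc (c : R) : mu.-integrable (`[a, a + dl[ : set R) (EFin \o cst c).
  by apply: (@integrable_co _ `|c|) => //; exact: measurable_cst.
have fi : mu.-integrable (`[a, a + dl[ : set R) (EFin \o f) by exact: integrable_co fC.
have mdf : measurable_fun setT (fun t => f t - f a) by exact: measurable_funB.
have dfC x : `|f x - f a| <= C + C.
  by apply: le_trans (ler_normB _ _) _; exact: lerD (fC _) (fC _).
have dint : mu.-integrable (`[a, a + dl[ : set R) (EFin \o (fun t => f t - f a)).
  exact: integrable_co mdf dfC.
rewrite -(cst_int (f a)) -(cst_int (K * dl)) -RintegralB//; last exact: mc.
apply: le_trans (le_normr_Rintegral _ _) _ => //.
apply: le_Rintegral => //; last 2 first.
- exact: mc.
- move=> x /=; rewrite in_itv/= => /andP[ax xa].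
  have := fK a (dl := x - a); rewrite subr_ge0 ax [a + _]addrC subrK => /(_ isT) H.
  apply: le_trans H _; rewrite ler_wpM2l//; last by lra.
  by have := fK 0 (dl := 1) ler01; rewrite mulr1; apply: le_trans.
apply: (@integrable_co _ (C + C)); first exact: measurableT_comp.
by move=> x; rewrite normr_id.
Qed.

Lemma riemann_sum_error L : (0 < L)%N ->
  `|\int[mu]_(x in `[0, 1[) f x - (\sum_(b < L) f (b%:R / L%:R)) / L%:R| <= K / L%:R.
Proof.
move=> L0; have L0R : 0 < L%:R :> R by rewrite ltr0n.
pose dl : R := L%:R^-1; have dl0 : 0 <= dl by rewrite invr_ge0.
have H n : `|\int[mu]_(x in `[0, n%:R * dl[) f x - \sum_(b < n) dl * f (b%:R * dl)| <=
    n%:R * (dl * (K * dl)).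
  elim: n => [|n IH].
    rewrite big_ord0 !mul0r subr0 set_itv_ge ?bnd_simp ?ltxx//.
    by rewrite Rintegral_set0 normr0.
  have E : n.+1%:R * dl = n%:R * dl + dl by rewrite -natr1 mulrDl mul1r.
  have n0 : 0 <= n%:R * dl by rewrite mulr_ge0.
  have -> : `[0, n.+1%:R * dl[ = `[0, n%:R * dl[ `|` `[n%:R * dl, n%:R * dl + dl[ :> set R.
    by rewrite E -itv_bndbnd_setU// bnd_simp// lerDl.
  rewrite Rintegral_setU//; last 2 first.
  - rewrite -itv_bndbnd_setU ?bnd_simp ?lerDl//; exact: integrable_co fC.
  - apply/disj_setPS => x [] /=; rewrite !in_itv/= => /andP[_ x1] /andP[x2 _].
    by move: x1; rewrite ltNge x2.
  rewrite big_ord_recr/=; set I1 := \int[mu]_(x in `[0, _[) _; set I2 := \int[mu]_(x in _) _.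
  have := cell_integral_error (n%:R * dl) dl0; rewrite -/I2 => H2.
  have -> : I1 + I2 - (\sum_(i < n) dl * f (i%:R * dl) + dl * f (n%:R * dl)) =
     (I1 - \sum_(i < n) dl * f (i%:R * dl)) + (I2 - dl * f (n%:R * dl)) by ring.
  apply: le_trans (ler_normD _ _) _; apply: le_trans (lerD IH H2) _.
  by rewrite -natr1; lra.
have := H L; have -> : L%:R * dl = 1 by rewrite divff ?gt_eqF.
have -> : L%:R * (dl * (K * dl)) = K / L%:R.
  by rewrite mulrA [L%:R * dl]divff ?gt_eqF// mul1r.
by rewrite -mulr_sumr mulrC.
Qed.

End RiemannSums.

Section PeriodizationIntegral.
Variables (R : realType) (s : nat).
Local Notation r := s.+2.
Local Notation W := (2 * r + 1)%N.
Local Notation N := (2 * W + 1)%N.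
Local Notation mu := (@lebesgue_measure R).
Variables (u z : R).
Hypothesis u0 : 0 < u.
Hypothesis u1 : u <= 1.

Lemma hat_per_ge0 x : 0 <= hat_per s u z x.
Proof. by apply: sumr_ge0 => i _; case/andP: ((hat_bounds u0 u1 s.+1).2 (i%:R - W%:R + x - z)). Qed.

Lemma normr_hat_per_le x : `|hat_per s u z x| <= N%:R.
Proof.
rewrite ger0_norm ?hat_per_ge0//.
apply: le_trans (_ : \sum_(i < N) 1 <= _); last by rewrite sumr_const card_ord.
by apply: ler_sum => i _; case/andP: ((hat_bounds u0 u1 s.+1).2 (i%:R - W%:R + x - z)).
Qed.

Lemma hat_per_lipschitz x dl : 0 <= dl ->
  `|hat_per s u z (x + dl) - hat_per s u z x| <= (N%:R * 2) * dl.
Proof.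
move=> dl0; rewrite /hat_per -sumrB; apply: le_trans (ler_norm_sum _ _ _) _.
have -> : N%:R * 2 * dl = \sum_(i < N) 2 * dl by rewrite sumr_const card_ord -[RHS]mulr_natl mulrA.
apply: ler_sum => i _; rewrite addrA [_ + dl - z]addrAC.
exact: hat_lipschitz.
Qed.

Lemma measurable_hat_per : measurable_fun setT (hat_per s u z).
Proof. exact: lipschitz_measurable hat_per_lipschitz. Qed.

Lemma hat_per_mean_error L : (0 < L)%N ->
  `|\int[mu]_(x in `[0, 1[) hat_per s u z x - (\sum_(b < L) hat_per s u z (b%:R / L%:R)) / L%:R|
  <= (N%:R * 2) / L%:R.
Proof. exact: riemann_sum_error measurable_hat_per normr_hat_per_le hat_per_lipschitz _. Qed.

End PeriodizationIntegral.

Section PeriodicProduct.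
Variables (R : realType) (s d : nat).
Local Notation r := s.+2.
Local Notation W := (2 * r + 1)%N.
Local Notation N := (2 * W + 1)%N.

(** The nonzero terms of the sum over Z^d lie in a cube, over which the product
structure factors the sum. *)
Lemma hat_periodicE (x z u : d.-tuple R) :
  unit_cube x -> unit_cube z -> half_cube u ->
  hat_periodic r x z u = \prod_j hat_per s (tnth u j) (tnth z j) (tnth x j).
Proof.
move=> cx cz cu.
pose sh (g : {ffun 'I_d -> 'I_N}) : d.-tuple int := [tuple (g j)%:Z - W%:Z | j < d].
have sh_inj : injective sh.
  move=> g g' E; apply/ffunP => j; apply/val_inj.
  have := congr1 (fun t => tnth t j) E; by rewrite /= /sh !tnth_mktuple => /addIr [].
pose F k := hat_prod r [tuple (tnth k j)%:~R + tnth x j | j < d] z u.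
have -> : hat_periodic r x z u = \sum_(k \in [set` [seq sh g | g : {ffun 'I_d -> 'I_N}]]) F k.
  apply/esym/fsbig_widen => // k [_ /= kN]; rewrite /F /hat_prod.
  have [j kj] : exists j, (W < `|tnth k j|)%N.
    apply/existsP; apply: contra_notT kN => /existsPn Hk.
    have bnd (j : 'I_d) : (`|(tnth k j + W%:Z)%R| < N)%N.
      by have := Hk j; move: (tnth k j : int) => y; lia.
    apply/mapP; exists [ffun j => Ordinal (bnd j)]; first by rewrite mem_enum.
    apply: eq_from_tnth => j; rewrite tnth_mktuple ffunE/=.
    by have := Hk j; move: (tnth k j : int) => y; lia.
  rewrite (bigD1 j)//= tnth_mktuple hat_support_r ?mul0r//.
  - by have /andP[] := cu j.
  - by have /andP[] := cu j.
  have /andP[x0 x1] := cx j; have /andP[z0 z1] := cz j.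
  have kjR : W%:R + 1 <= `|(tnth k j)%:~R| :> R.
    by rewrite -intr_norm -natr_absz natr1 ler_nat.
  have := lerB_normD (tnth k j)%:~R (tnth x j - tnth z j).
  rewrite addrA; have : `|tnth x j - tnth z j| <= 1 by rewrite ler_norml; lra.
  have W2 : W%:R = 2 * r%:R + 1 :> R by rewrite natrD natrM.
  have r0 : 0 <= r%:R :> R by [].
  by move: kjR r0; rewrite W2; lra.
rewrite -fsbig_seq; last by rewrite map_inj_uniq ?enum_uniq.
rewrite big_map big_enum/= /hat_per bigA_distr_bigA/=; apply: eq_bigr => g _.
rewrite /F /hat_prod; apply: eq_bigr => j _; rewrite !tnth_mktuple.
by rewrite rmorphB/=.
Qed.

End PeriodicProduct.

(** * Integrals of products over the unit cube *)

Section ProductIntegral.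
Variable R : realType.
Local Notation mu := (@lebesgue_measure R).
Local Notation RT := (measurableTypeR R).

Lemma measurable_tuple_prod d (g : 'I_d -> R -> R) :
  (forall j, measurable_fun setT (g j)) ->
  measurable_fun setT (fun x : d.-tuple RT => \prod_j g j (tnth x j)).
Proof.
move=> mg; apply: measurable_prod => j _.
exact: (measurableT_comp (mg j) (measurable_tnth j)).
Qed.

(** Tonelli's theorem, one coordinate at a time. *)
Lemma integral_tuple_prod d (g : 'I_d -> R -> R) (I : 'I_d -> R) :
  (forall j, measurable_fun setT (g j)) -> (forall j x, 0 <= g j x) ->
  (forall j, (\int[mu]_x (g j x)%:E = (I j)%:E)%E) ->
  (\int[lebesgue_tuple R d]_x (\prod_j g j (tnth x j))%:E = (\prod_j I j)%:E)%E.
Proof.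
elim: d g I => [|d IH] g I mg g0 gI.
  rewrite /= integral_dirac ?diracT ?mul1e ?big_ord0//.
  by apply/measurable_EFinP; exact: measurable_tuple_prod mg.
rewrite [LHS]/=.
transitivity (\int[(mu \x lebesgue_tuple R d)%E]_p
   ((g ord0 p.1 * \prod_j g (lift ord0 j) (tnth p.2 j))%:E))%E.
  rewrite /lebesgue_succ ge0_integral_pushforward//.
  - rewrite preimage_setT; apply: eq_integral => -[a x] _ /=; congr EFin.
    rewrite big_ord_recl/= tnth0; congr (_ * _); apply: eq_bigr => j _.
    by rewrite tnthS.
  - exact: measurable_tuple_cons.
  - by apply/measurable_EFinP; exact: measurable_tuple_prod mg.
  - by move=> x _; rewrite lee_fin; apply: prodr_ge0.
rewrite fubini_tonelli1/=; last 2 first.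
- apply/measurable_EFinP; apply: measurable_funM.
    exact: measurableT_comp (mg ord0) measurable_fst.
  exact: (measurableT_comp (measurable_tuple_prod (fun j => mg (lift ord0 j))) measurable_snd).
- by move=> x; rewrite lee_fin mulr_ge0//; apply: prodr_ge0.
rewrite /fubini_F/=.
transitivity (\int[mu]_x ((g ord0 x)%:E * (\prod_j I (lift ord0 j))%:E))%E.
  apply: eq_integral => x _.
  rewrite -(IH (fun j => g (lift ord0 j)))//.
  rewrite -ge0_integralZl_EFin//.
  - by move=> y _; rewrite lee_fin; apply: prodr_ge0.
  - apply/measurable_EFinP.
    exact: (measurable_tuple_prod (fun j => mg (lift ord0 j))).
rewrite ge0_integralZr//.
- by rewrite gI big_ord_recl EFinM.
- by apply/measurable_EFinP; exact: mg.
- by move=> x _; rewrite lee_fin.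
- rewrite lee_fin; apply: prodr_ge0 => j _; rewrite -lee_fin -gI.
  by apply: integral_ge0 => x _; rewrite lee_fin.
Qed.

Lemma Rintegral_unit_cube_prod d (g : 'I_d -> R -> R) (C : R) :
  (forall j, measurable_fun setT (g j)) -> (forall j x, 0 <= g j x) ->
  (forall j x, `|g j x| <= C) ->
  \int[lebesgue_tuple R d]_(x in @unit_cube R d) (\prod_j g j (tnth x j)) =
  \prod_j \int[mu]_(x in `[0, 1[) g j x.
Proof.
move=> mg g0 gC; rewrite Rintegral_mkcond /Rintegral.
pose I01 : R -> R := \1_(`[0, 1[ : set R).
pose h j x := g j x * I01 x.
have -> : (\int[lebesgue_tuple R d]_x
    (((fun x : d.-tuple R => \prod_j g j (tnth x j)) \_ (@unit_cube R d)) x)%:E)%E =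
    (\int[lebesgue_tuple R d]_x (\prod_j h j (tnth x j))%:E)%E.
  apply: eq_integral => x _; congr EFin; rewrite /h big_split/= patchE.
  case: ifPn => [/set_mem xin|/negP xout].
    rewrite [X in _ * X]big1 ?mulr1// => j _.
    by rewrite /I01 indicE mem_set//= in_itv/=; have := xin j.
  have [j Hj] : exists j, ~~ (0 <= tnth x j < 1).
    apply/existsP; apply: contra_notT xout => /existsPn H.
    by rewrite inE => j; have := H j; rewrite negbK.
  rewrite [X in _ = _ * X](bigD1 j)//= /I01 indicE memNset ?mul0r ?mulr0//=.
  by rewrite in_itv/=; apply/negP.
rewrite (@integral_tuple_prod d h (fun j => \int[mu]_(x in `[0, 1[) g j x)) //.
- move=> j; apply: measurable_funM => //; apply: measurable_indic; exact: measurable_itv.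
- by move=> j x; rewrite mulr_ge0// /I01 indicE.
move=> j; rewrite /Rintegral.
have -> : (\int[mu]_x (h j x)%:E)%E = (\int[mu]_(x in (`[0%R, 1%R[ : set R)) (g j x)%:E)%E.
  rewrite [RHS]integral_mkcond; apply: eq_integral => x _.
  by rewrite patchE /h /I01 indicE; case: ifP => _; rewrite ?mulr1 ?mulr0.
rewrite fineK//; apply: integrable_fin_num => //.
exact: integrable_co (mg j) (gC j).
Qed.

End ProductIntegral.

(** * The discrepancy bound *)

Section Assembly.
Variable R : realType.

Lemma normr_prod_sub_le d (a b : 'I_d -> R) (c e : R) : 1 <= c -> 0 <= e ->
  (forall j, `|a j| <= c) -> (forall j, `|b j| <= c) -> (forall j, `|a j - b j| <= e) ->
  `|\prod_j a j - \prod_j b j| <= d%:R * (c ^+ d * e).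
Proof.
move=> c1 e0; elim: d a b => [|d IH] a b ac bc ab.
  by rewrite !big_ord0 subrr normr0 mul0r.
rewrite !big_ord_recl/=; set pa := \prod_(i < d) a _; set pb := \prod_(i < d) b _.
have -> : a ord0 * pa - b ord0 * pb = a ord0 * (pa - pb) + (a ord0 - b ord0) * pb by ring.
apply: le_trans (ler_normD _ _) _; rewrite !normrM.
have c0 : 0 <= c by exact: le_trans ler01 c1.
have IH' : `|pa - pb| <= d%:R * (c ^+ d * e) by apply: IH.
have pbc : `|pb| <= c ^+ d.
  rewrite /pb normr_prod -[X in c ^+ X]card_ord -prodr_const.
  by apply: ler_prod => j _; rewrite normr_ge0 bc.
have t1 : `|a ord0| * `|pa - pb| <= c * (d%:R * (c ^+ d * e)) by exact: ler_pM.
have t2 : `|a ord0 - b ord0| * `|pb| <= e * c ^+ d by exact: ler_pM.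
apply: le_trans (lerD t1 t2) _.
have : e * c ^+ d <= c * (c ^+ d * e).
  by rewrite mulrC ler_peMl// mulr_ge0// exprn_ge0.
by rewrite -natr1 exprS; lra.
Qed.

Lemma zero_in_cube d : unit_cube [tuple (0 : R) | _ < d].
Proof. by move=> j; rewrite tnth_mktuple lexx ltr01. Qed.

(** When there are fewer than [m] nodes, the remaining ones are placed at the
origin with weight [0]. *)
Lemma optimal_discrepancy_le d r m (T : finType) (Nd : {set T}) (node : T -> d.-tuple R)
    (wt : T -> R) (eps : R) :
  (#|Nd| <= m)%N -> (forall b, unit_cube (node b)) ->
  (forall z u, unit_cube z -> half_cube u ->
    `|\int[lebesgue_tuple R d]_(x in @unit_cube R d) hat_periodic r x z u -
      \sum_(b in Nd) wt b * hat_periodic r (node b) z u| <= eps) ->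
  (optimal_discrepancy R d r m <= eps%:E)%E.
Proof.
move=> Nm node01 err.
pose E := enum Nd.
pose nodes := [seq node b | b <- E]; pose wts := [seq wt b | b <- E].
pose xi (mu : 'I_m) := nth [tuple 0 | _ < d] nodes mu.
pose la (mu : 'I_m) := nth 0 wts mu.
have sumE z u : \sum_(mu < m) la mu * hat_periodic r (xi mu) z u =
    \sum_(b in Nd) wt b * hat_periodic r (node b) z u.
  pose F i := nth 0 wts i * hat_periodic r (nth [tuple 0 | _ < d] nodes i) z u.
  have szE : size E = #|Nd| by rewrite -cardE.
  rewrite -[LHS]/(\sum_(mu < m) F mu) -(big_mkord xpredT F).
  rewrite (big_cat_nat (leq0n #|Nd|) Nm)/= [X in _ + X]big_nat_cond [X in _ + X]big1 ?addr0; last first.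
    move=> i /andP[/andP[Ni im] _]; rewrite /F nth_default ?mul0r// size_map szE //.
  rewrite -big_enum/= -/E.
  have -> : \sum_(b <- E) wt b * hat_periodic r (node b) z u =
     \sum_(p <- zip wts nodes) p.1 * hat_periodic r p.2 z u.
    by rewrite /wts /nodes zip_map big_map.
  rewrite (big_nth (0, [tuple 0 | _ < d])) size_zip !size_map minnn szE.
  apply: eq_big_nat => i /andP[_ iN].
  by rewrite nth_zip ?size_map.
rewrite /optimal_discrepancy.
apply: le_trans (ereal_inf_lbound _) _.
  exists xi; last reflexivity.
  move=> mu /=; rewrite /xi; have [iN|iN] := ltnP mu (size nodes); last first.
    by rewrite nth_default//; exact: zero_in_cube.
  by have /mapP[b _ ->] := mem_nth [tuple 0 | _ < d] iN.
apply: le_trans (ereal_inf_lbound _) _; first by exists la.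
apply: ge_ereal_sup => _ [z zc] [u uc] <-.
by rewrite lee_fin /quadrature_error sumE; exact: err.
Qed.

Section Dimension.
Variables (d' s : nat).
Local Notation d := d'.+1.
Local Notation r := s.+2.
Local Notation W := (2 * r + 1)%N.
Local Notation N := (2 * W + 1)%N.
Local Notation mu := (@lebesgue_measure R).

Lemma half_cube_bounds n (u : n.-tuple R) j : half_cube u ->
  [/\ 0 < tnth u j, tnth u j <= 1 / 2 & tnth u j <= 1].
Proof. by move=> /(_ j)/andP[a b]; split=> //; lra. Qed.

Lemma integral_hat_periodic (z u : d.-tuple R) : unit_cube z -> half_cube u ->
  \int[lebesgue_tuple R d]_(x in @unit_cube R d) hat_periodic r x z u =
  \prod_j \int[mu]_(x in `[0, 1[) hat_per s (tnth u j) (tnth z j) x.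
Proof.
move=> zc uc.
rewrite -(@Rintegral_unit_cube_prod _ _ (fun j => hat_per s (tnth u j) (tnth z j)) N%:R).
- by apply: eq_Rintegral => x /set_mem xc; exact: hat_periodicE.
- by move=> j; have [a _ c] := half_cube_bounds j uc; exact: measurable_hat_per.
- by move=> j x; have [a _ c] := half_cube_bounds j uc; exact: hat_per_ge0.
- by move=> j x; have [a _ c] := half_cube_bounds j uc; exact: normr_hat_per_le.
Qed.

Lemma normr_integral_hat_per u z : 0 < u -> u <= 1 ->
  `|\int[mu]_(x in `[0, 1[) hat_per s u z x| <= N%:R.
Proof.
move=> u0 u1.
have ih := integrable_co 0 1 (measurable_hat_per s z u0 u1) (normr_hat_per_le s z u0 u1).
have ic := integrable_co 0 1 (measurable_cst (N%:R : R)) (fun=> lexx `|N%:R : R|).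
apply: le_trans (le_normr_Rintegral _ _) _ => //.
have -> : N%:R = \int[mu]_(x in `[0, 1[) (N%:R : R).
  by rewrite Rintegral_cst//= lebesgue_measure_itv/= lte_fin ltr01 oppr0 adde0 mulr1.
apply: le_Rintegral => //; first exact: integrable_norm.
by move=> x _; exact: normr_hat_per_le.
Qed.

Let Cf : R := 2 ^+ r + N%:R.
Let Ctot : R := 1 + (Cf * (8 * 4 ^+ r)) ^+ d * 2 ^+ (r * d + 2 * d).

(** The lattice of norm level [q * d] has about 2^(q d) nodes in the window. The
factor [K] in its construction makes [L] so large that the Riemann sum error is
at most 2^(- q d r), below the error of the lattice rule. *)
Lemma quadrature_at_scale : exists2 A : nat, (0 < A)%N & forall q m,
  (A * 2 ^ (q * d) <= m)%N ->
  (optimal_discrepancy R d r m <= (Ctot * (2 ^- (q * d * r) * (q * d).+1%:R ^+ d'))%:E)%E.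
Proof.
have [A A0 HA] := exists_frequency_lattice R (isT : 0 < d)%N.
exists ((r * (2 * d * A)) ^ d)%N; first by rewrite expn_gt0 !muln_gt0 A0.
move=> q m Am.
pose K := (d * N ^ d * (N * 2) * 2 ^ (q * d * r))%N.
have K0 : (0 < K)%N by rewrite !muln_gt0 !expn_gt0 addn1.
have [M' [P [L [K' [H [[PL KL LE K'0 Hcard] [H0 Hsub Hnorm]]]]]]] := HA q K K0.
have P0 : (0 < P)%N by move: PL; case: (P).
have L0 : (0 < L)%N by exact: leq_trans KL.
have L0R : 0 < L%:R :> R by rewrite ltr0n.
have [t Ht] := lattice_rule_nodes R L (r := r) isT H0 Hsub.
set Nd := [set b in _ | _] in Ht.
pose node (b : {ffun 'I_d -> 'I_M'.+2}) : d.-tuple R :=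
  [tuple ((b j + t j)%R %% L)%N%:R / L%:R | j < d].
pose wt (b : {ffun 'I_d -> 'I_M'.+2}) : R :=
  #|H|%:R / L%:R ^+ d * \prod_j bspline R L r (b j + t j).
apply: (@optimal_discrepancy_le d r m _ Nd node wt).
- have : (#|Nd| * K' ^ d <= (r * L) ^ d)%N.
    by apply: leq_trans Ht; rewrite leq_mul2l Hcard orbT.
  have -> : (r * L = (r * (2 * d * A)) * 2 ^ q * K')%N by rewrite LE; ring.
  rewrite expnMn leq_pmul2r ?expn_gt0 ?K'0// expnMn -expnM => H1.
  exact: leq_trans H1 Am.
- move=> b j; rewrite tnth_mktuple divr_ge0//= ltr_pdivrMr// mul1r ltr_nat.
  by rewrite ltn_pmod.
move=> z u zc uc; rewrite integral_hat_periodic//.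
pose F (j : 'I_d) (c : nat) := hat_per s (tnth u j) (tnth z j) (c%:R / L%:R).
have nodec b : unit_cube (node b).
  by move=> j; rewrite tnth_mktuple divr_ge0//= ltr_pdivrMr// mul1r ltr_nat ltn_pmod.
have -> : \sum_(b in Nd) wt b * hat_periodic r (node b) z u = lattice_rule L r H t F.
  rewrite /lattice_rule mulr_sumr [RHS](bigID (fun b => b \in Nd))/= [X in _ = _ + X]big1 ?addr0.
    apply: eq_big => [b|b bN].
      by rewrite /Nd inE; case: (b \in dual R H).
    rewrite big_split (hat_periodicE s (nodec b) zc uc) mulrA; congr (_ * _).
    by apply: eq_bigr => j _; rewrite tnth_mktuple.
  move=> b /andP[bD]; rewrite inE bD/= => /forallPn[j]; rewrite inE negbK => /eqP bj.
  by rewrite (bigD1 j)//= bj !mul0r mulr0.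
set Iz := \prod_j _; set mean := \prod_j ((\sum_(b < L) F j b) / L%:R).
have Cf0 : 0 <= Cf by rewrite addr_ge0// exprn_ge0.
have e1 : `|Iz - mean| <= 2 ^- (q * d * r).
  apply: le_trans (@normr_prod_sub_le d _ _ N%:R ((N%:R * 2) / L%:R) _ _ _ _ _) _.
  - by rewrite ler1n addn1.
  - by rewrite divr_ge0// mulr_ge0.
  - by move=> j; have [a _ c] := half_cube_bounds j uc; exact: normr_integral_hat_per.
  - move=> j; have [a _ c] := half_cube_bounds j uc.
    rewrite normrM normfV normr_nat ler_pdivrMr//.
    apply: le_trans (ler_norm_sum _ _ _) _.
    have -> : N%:R * L%:R = \sum_(b < L) N%:R :> R by rewrite sumr_const card_ord mulr_natr.
    by apply: ler_sum => b _; exact: normr_hat_per_le.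
  - by move=> j; have [a _ c] := half_cube_bounds j uc; exact: hat_per_mean_error.
  rewrite !mulrA ler_pdivrMr//; apply: le_trans (_ : 2 ^- (q * d * r) * K%:R <= _); last first.
    by rewrite ler_wpM2l ?invr_ge0 ?exprn_ge0// ler_nat.
  rewrite /K natrM (natrX _ 2 (q * d * r)) mulrCA mulVf ?expf_neq0 ?pnatr_eq0// mulr1.
  by rewrite !natrM natrX !mulrA.
have e2 : `|lattice_rule L r H t F - mean| <=
    (Cf * (8 * 4 ^+ r)) ^+ d * (2 ^+ (r * d + 2 * d) * 2 ^- (q * d * r) * (q * d).+1%:R ^+ d').
  have dftF j l : (l < L)%N ->
      Normc.normc (dft L (F j) l) <= L%:R * (Cf * decay R 1 (minn l (L - l)) ^+ r).
    by move=> lL; have [a b c] := half_cube_bounds j uc; exact: dft_hat_per.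
  have err := lattice_rule_error PL t (isT : (1 < r)%N) H0 Hsub Cf0 dftF.
  apply: le_trans err _.
  apply: ler_wpM2l.
    by apply/exprn_ge0/mulr_ge0 => //; apply: mulr_ge0 => //; exact: exprn_ge0.
  exact: sum_decay_lattice.
have := ler_normB (Iz - mean) (lattice_rule L r H t F - mean).
rewrite opprB addrA subrK => /le_trans; apply.
apply: le_trans (lerD e1 e2) _.
set Q := 2 ^- (q * d * r); set Y := (q * d).+1%:R ^+ d'.
have Q0 : 0 <= Q by rewrite invr_ge0 exprn_ge0.
have Y1 : 1 <= Y by rewrite exprn_ege1// ler1n.
have QY : Q <= Q * Y by rewrite ler_peMr.
rewrite /Ctot; move: ((Cf * _) ^+ d) (2 ^+ _) => x y.
have -> : (1 + x * y) * (Q * Y) = Q * Y + x * (y * Q * Y) by ring.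
by rewrite lerD2r.
Qed.

Lemma discrepancy_trivial m : (optimal_discrepancy R d r m <= (N%:R ^+ d)%:E)%E.
Proof.
apply: (@optimal_discrepancy_le d r m unit (finset.set0) (fun=> [tuple (0:R) | _ < d]) (fun=> 0) (N%:R ^+ d)).
- by rewrite cards0.
- by move=> _; exact: zero_in_cube.
move=> z u zc uc; rewrite finset.big_set0 subr0 integral_hat_periodic// normr_prod.
rewrite -[X in _ ^+ X](card_ord d) -prodr_const; apply: ler_prod => j _.
by have [a _ c] := half_cube_bounds j uc; rewrite normr_ge0/= normr_integral_hat_per.
Qed.

(** The scale [q] is the largest for which the rule fits in [m] nodes, so that
2^(q d) is of order [m] and [q * d] at most of order log m. For the finitely many [m]
below the number of nodes of the first rule, the trivial bound suffices. *)
Lemma discrepancy_bound : exists C : R, forall m, (2 <= m)%N ->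
  (optimal_discrepancy R d r m <= (C * m%:R ^- r * ln m%:R ^+ d')%:E)%E.
Proof.
have [A A0 HA] := quadrature_at_scale.
have Ctot0 : 0 <= Ctot.
  have Cf0 : 0 <= Cf by rewrite addr_ge0// exprn_ge0.
  by rewrite addr_ge0// mulr_ge0// exprn_ge0// mulr_ge0// mulr_ge0// exprn_ge0.
have ln20 : 0 < ln 2 :> R by rewrite ln_gt0// ltr1n.
pose C1 : R := N%:R ^+ d * A%:R ^+ r / ln 2 ^+ d'.
pose C2 : R := Ctot * (A * 2 ^ d)%:R ^+ r * (2 / ln 2) ^+ d'.
have C10 : 0 <= C1.
  by apply: divr_ge0; [apply: mulr_ge0; exact: exprn_ge0|exact/exprn_ge0/ltW].
have C20 : 0 <= C2.
  apply: mulr_ge0; first by apply: mulr_ge0 => //; exact: exprn_ge0.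
  by apply/exprn_ge0/divr_ge0 => //; exact: ltW.
exists (C1 + C2) => m m2.
have m0 : 0 < m%:R :> R by rewrite ltr0n; lia.
have lnm : ln 2 <= ln m%:R :> R by rewrite ler_ln ?posrE// ler_nat.
have lnm0 : 0 < ln m%:R :> R by exact: lt_le_trans lnm.
have tail0 : 0 <= m%:R ^- r * ln m%:R ^+ d' :> R.
  by rewrite mulr_ge0 ?invr_ge0 ?exprn_ge0 ?(ltW lnm0) ?(ltW m0).
have [mA|Am] := ltnP m A.
  apply: le_trans (discrepancy_trivial m) _; rewrite lee_fin.
  apply: le_trans (_ : C1 * m%:R ^- r * ln m%:R ^+ d' <= _); last first.
    by rewrite -[leLHS]mulrA -[leRHS]mulrA ler_wpM2r// lerDl.
  rewrite /C1.
  have h1 : 1 <= A%:R ^+ r * m%:R ^- r :> R.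
    rewrite -exprVn -exprMn exprn_ege1// ler_pdivlMr// mul1r ler_nat; exact: ltnW.
  have h2 : 1 <= ln m%:R ^+ d' / ln 2 ^+ d' :> R.
    by rewrite ler_pdivlMr ?exprn_gt0// mul1r lerXn2r ?nnegrE ?(ltW ln20) ?(ltW lnm0).
  have -> : N%:R ^+ d * A%:R ^+ r / ln 2 ^+ d' * m%:R ^- r * ln m%:R ^+ d' =
    N%:R ^+ d * ((A%:R ^+ r * m%:R ^- r) * (ln m%:R ^+ d' / ln 2 ^+ d')) :> R by ring.
  rewrite ler_peMr ?exprn_ge0//; apply: le_trans h1 _.
  by rewrite ler_peMr// (le_trans ler01).
pose q := trunc_log (2 ^ d) (m %/ A).
have d1 : (1 < 2 ^ d)%N by rewrite -{1}(expn0 2) ltn_exp2l.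
have mA0 : (0 < m %/ A)%N by rewrite divn_gt0.
have qm : (A * 2 ^ (q * d) <= m)%N.
  have := trunc_logP d1 mA0; rewrite -/q -expnM [(d * q)%N]mulnC leq_divRL//.
  by rewrite mulnC.
have mq : (m < A * 2 ^ d * 2 ^ (q * d))%N.
  have := trunc_log_ltn (m %/ A) d1; rewrite -/q -expnM mulnS ltn_divLR// expnD.
  by rewrite [(d * q)%N]mulnC mulnC mulnA.
apply: le_trans (HA q m qm) _; rewrite lee_fin.
apply: le_trans (_ : C2 * m%:R ^- r * ln m%:R ^+ d' <= _); last first.
  by rewrite -[leLHS]mulrA -[leRHS]mulrA ler_wpM2r// lerDr.
have b1 : 2 ^- (q * d * r) <= (A * 2 ^ d)%:R ^+ r * m%:R ^- r :> R.
  rewrite exprM -exprVn -[m%:R ^- r]exprVn -exprMn lerXn2r ?nnegrE ?mulr_ge0 ?invr_ge0 ?exprn_ge0 ?(ltW m0)//.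
  rewrite ler_pdivlMr// mulrC ler_pdivrMr ?exprn_gt0// -natrX -natrM ler_nat.
  exact: ltnW.
have b2 : (q * d).+1%:R <= 2 / ln 2 * ln m%:R :> R.
  have : (2 ^ (q * d) <= m)%N by apply: leq_trans qm; rewrite leq_pmull.
  rewrite -(ler_nat R) natrX => h.
  have {h} : ln (2 ^+ (q * d)) <= ln m%:R :> R by rewrite ler_ln ?posrE ?exprn_gt0.
  rewrite lnXn// => h.
  rewrite mulrAC ler_pdivlMr// -natr1 mulrDl mul1r.
  by move: h lnm; rewrite -[ln 2 *+ _]mulr_natl; set X := _ * _; set Y := ln m%:R; lra.
apply: le_trans (_ : Ctot * (((A * 2 ^ d)%:R ^+ r * m%:R ^- r) *
    (2 / ln 2 * ln m%:R) ^+ d') <= _).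
  rewrite ler_wpM2l//; apply: ler_pM => //; rewrite ?invr_ge0 ?exprn_ge0//.
  by apply: lerXn2r; rewrite ?nnegrE//; exact: le_trans b2.
rewrite /C2 exprMn; move: ((A * 2 ^ d)%:R ^+ r) (m%:R ^- r) => x y.
by rewrite le_eqVlt; apply/orP; left; apply/eqP; ring.
Qed.

End Dimension.
End Assembly.

Theorem mainTheorem3 (R : realType) (d r : nat) (hd : (2 <= d)%N)
    (hr : (2 <= r)%N) :
  exists C : R, forall m : nat, (2 <= m)%N ->
    (optimal_discrepancy R d r m <=
      (C * m%:R ^- r * ln (m%:R) ^+ (d - 1))%:E)%E.
Proof.
case: d hd => // d _; case: r hr => [|[|s]]// _; rewrite subn1/=.
exact: discrepancy_bound.
Qed.
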